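(* Let $F\subseteq[0,1]^2$ be the Bedford-McMullen carpet determined by integers $n>m\geq 2$ and a digit set $D\subseteq\{0,\ldots,m-1\}\times\{0,\ldots,n-1\}$ with at least two elements, such that the non-zero column counts $n_p$ are not all equal. Let $a=\max_{\ell\in D}a_\ell$. Then for $0<\theta <\frac{1}{4}(\log_n m)^2$, $$\overline{\dim}_\theta F \ \leq \ \dim_{\mathrm{H}} F + \bigg(\frac{2\log(\log_m n)\log a}{\log n}\bigg) \frac{1}{-\log \theta}.$$ In particular, $\theta\mapsto\underline{\dim}_\theta F$ and $\theta\mapsto\overline{\dim}_\theta F$ are continuous at $\theta = 0$ and so are continuous on $[0,1]$.
   Context: Bedford-McMullen carpet: for $(p,q)\in D$ let $S_{(p,q)}\colon[0,1]^2\to[0,1]^2$, $S_{(p,q)}(x,y)=\big(\frac{x+p}{m},\frac{y+q}{n}\big)$; $F$ is the unique non-empty compact set with $F=\bigcup_{(p,q)\in D}S_{(p,q)}(F)$. For $0\le p\le m-1$, $n_p$ is the number of $q$ with $(p,q)\in D$. For $\ell=(p_\ell,q_\ell)\in D$, $a_\ell=n_{p_\ell}$ is the number of elements of $D$ in the same column as $\ell$. (Non-zero $n_p$ not all equal implies $a\ge2$.) Intermediate dimensions: $|U|$ denotes the diameter of $U$, and a cover $\{U_i\}$ of $F$ is a finite or countable collection of sets with $F\subseteq\bigcup_i U_i$. For bounded $F\subseteq\mathbb{R}^2$ and $0\leq\theta\leq 1$, $\underline{\dim}_{\theta} F$ is the infimum of all $s\geq 0$ such that for all $\epsilon>0$ and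 all $\delta_0>0$ there exist $0<\delta\leq\delta_0$ and a cover $\{U_i\}$ of $F$ with $\delta^{1/\theta}\leq |U_i|\leq\delta$ for all $i$ and $\sum_i |U_i|^s\leq\epsilon$. $\overline{\dim}_{\theta} F$ is the infimum of all $s\geq 0$ such that for all $\epsilon>0$ there exists $\delta_0>0$ such that for all $0<\delta\leq\delta_0$ there is a cover $\{U_i\}$ of $F$ with $\delta^{1/\theta}\leq |U_i|\leq\delta$ for all $i$ and $\sum_i |U_i|^s\leq\epsilon$. When $\theta=0$, $\delta^{1/\theta}$ is read as $0$, so that $\underline{\dim}_0F=\overline{\dim}_0F=\dim_{\mathrm{H}}F$, the Hausdorff dimension. *)

(* Defs.v *)
From mathcomp Require Import all_boot all_order all_algebra.
From mathcomp Require Import all_classical all_reals all_analysis.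

Set Implicit Arguments.
Unset Strict Implicit.
Unset Printing Implicit Defensive.

Import Order.TTheory GRing.Theory Num.Theory.
Import numFieldNormedType.Exports.

Local Open Scope classical_set_scope.
Local Open Scope ring_scope.

Section Dimensions.
Context {R : realType}.
Implicit Types (F V : set (R * R)) (I : set nat) (U : nat -> set (R * R)).

(* The norm that the library puts on R * R is the max norm, so the Euclidean
   distance is spelled out. *)
Definition euclidean_dist (x y : R * R) : R :=
  Num.sqrt ((x.1 - y.1) ^+ 2 + (x.2 - y.2) ^+ 2).

(* The maximum with 0 only matters for V = set0, where the supremum is -oo. *)
Definition diam V : \bar R :=
  maxe 0%E (ereal_sup [set (euclidean_dist x y)%:E | x in V & y in V]).

(* The family (U i)_(i in I), with I a finite or infinite set of naturals,
   covers F, and every member has diameter between r and delta. *)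
Definition is_cover (r delta : R) F I U : Prop :=
  F `<=` \bigcup_(i in I) U i /\
  forall i, I i -> (r%:E <= diam (U i) <= delta%:E)%E.

Definition cover_sum (s : R) I U : \bar R :=
  (\esum_(i in I) (diam (U i) `^ s)%E)%E.

Definition hausdorff_premeasure (s delta : R) F : \bar R :=
  ereal_inf [set v : \bar R | exists I U,
    is_cover 0 delta F I U /\ v = cover_sum s I U].

Definition hausdorff_measure (s : R) F : \bar R :=
  ereal_sup [set hausdorff_premeasure s delta F |
    delta in [set delta : R | 0 < delta]].

(* The sets of exponents below contain every s > 2 when F is bounded, so that
   the infimum [inf] in R is the infimum of a nonempty set bounded below. *)
Definition hausdorff_dim F : R :=
  inf [set s : R | 0 <= s /\ hausdorff_measure s F = 0%E].

(* delta^(1/theta), read as 0 when theta = 0 *)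
Definition lower_scale (theta delta : R) : R :=
  if theta == 0 then 0 else delta `^ theta^-1.

Definition lower_intermediate_dim F (theta : R) : R :=
  inf [set s : R | 0 <= s /\
    forall eps : R, 0 < eps -> forall delta0 : R, 0 < delta0 ->
    exists2 delta : R, 0 < delta <= delta0 &
    exists I U, is_cover (lower_scale theta delta) delta F I U /\
      (cover_sum s I U <= eps%:E)%E].

Definition upper_intermediate_dim F (theta : R) : R :=
  inf [set s : R | 0 <= s /\
    forall eps : R, 0 < eps -> exists2 delta0 : R, 0 < delta0 &
    forall delta : R, 0 < delta <= delta0 ->
    exists I U, is_cover (lower_scale theta delta) delta F I U /\
      (cover_sum s I U <= eps%:E)%E].

Definition log_base (b x : R) : R := ln x / ln b.

End Dimensions.

Section Carpet.
Variables m n : nat.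
Implicit Types (D : {set 'I_m * 'I_n}).

Definition column_count D (p : 'I_m) : nat := #|[set q : 'I_n | (p, q) \in D]|.

Definition max_column_count D : nat := \max_(l in D) column_count D l.1.

Definition carpet_map (R : realType) (d : 'I_m * 'I_n) (x : R * R) : R * R :=
  ((x.1 + (d.1 : nat)%:R) / m%:R, (x.2 + (d.2 : nat)%:R) / n%:R).

(* By Hutchinson's theorem exactly one F satisfies this when D is nonempty. *)
Definition is_carpet (R : realType) D (F : set (R * R)) : Prop :=
  [/\ F `<=` `[0, 1] `*` `[0, 1], F !=set0, compact F &
      F = \bigcup_(d in [set` D]) (carpet_map d @` F)].

End Carpet.

(* Main.v *)
From HB Require Import structures.
Require Import Defs.
From mathcomp Require Import all_boot all_order all_algebra.
From mathcomp Require Import all_classical all_reals all_analysis.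
From mathcomp Require Import ring lra zify.

(** Put [L = log_n m], let [a] be the size of the column of a digit, and let [A_k]
be the sum of [ln a] over the first [k] digits of a word.  McMullen's measure, with
digit weights proportional to [a ^ (L - 1)], gives an approximate square of width
[m ^ -k] and height about [n ^ -l], [l = L k], the mass
[m ^ (- k d) exp (L A_k - A_l)].

Upper bound: along the levels [K, K / L, K / L ^ 2, ...] the averages [A_k / k]
stay between 0 and [ln a_max], so one of the first [N] steps lowers the average by
at most [ln a_max / N].  Hence every point lies in an approximate square of one of
these levels whose mass is at least a constant times the power
[d + ln a_max / (N ln n)] of its diameter, and the masses at each level sum to 1.
The [N] levels fit between [delta ^ (1 / theta)] and [delta] as soon as
[L ^ - N < 1 / theta].

Lower bound [d <= dim_H F], without any law of large numbers: group the words of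
length [M] by the number of times each column occurs.  By pigeonhole one of the
at most [(M + 1) ^ m] groups carries a fraction [(M + 1) ^ - m] of the weight.
The group is a digit set in base [(m ^ M, n ^ M)] whose nonempty columns all have
the same size, so counting words gives exactly the mass of approximate squares,
and the mass distribution principle applies to finite covers by balls.

Continuity on [(0, 1]] follows from
[dim_theta <= dim_phi <= (phi / theta) dim_theta] for [theta <= phi], obtained by
enlarging the sets that are too small. *)

Import Order.TTheory GRing.Theory Num.Theory.
Import numFieldNormedType.Exports.

Set Implicit Arguments.
Unset Strict Implicit.
Unset Printing Implicit Defensive.

Local Open Scope classical_set_scope.
Local Open Scope ring_scope.

(** * Diameters *)

Section Diameter.
Context {R : realType}.
Implicit Types (x y z : R * R) (V : set (R * R)).

Lemma euclidean_dist_ge0 x y : 0 <= euclidean_dist x y.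
Proof. exact: sqrtr_ge0. Qed.

Lemma euclidean_distxx x : euclidean_dist x x = 0.
Proof. by rewrite /euclidean_dist !subrr expr0n addr0 sqrtr0. Qed.

Lemma euclidean_distC x y : euclidean_dist x y = euclidean_dist y x.
Proof. by rewrite /euclidean_dist -(sqrrN (x.1 - _)) -(sqrrN (x.2 - _)) !opprB. Qed.

Lemma euclidean_dist_fst x y : `|x.1 - y.1| <= euclidean_dist x y.
Proof. by rewrite -sqrtr_sqr ler_wsqrtr// lerDl sqr_ge0. Qed.

Lemma euclidean_dist_snd x y : `|x.2 - y.2| <= euclidean_dist x y.
Proof. by rewrite -sqrtr_sqr ler_wsqrtr// lerDr sqr_ge0. Qed.

Lemma euclidean_dist_le x y :
  euclidean_dist x y <= `|x.1 - y.1| + `|x.2 - y.2|.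
Proof.
rewrite /euclidean_dist -[leRHS]ger0_norm ?addr_ge0// -sqrtr_sqr ler_wsqrtr//.
rewrite -(real_normK (num_real (x.1 - y.1))) -(real_normK (num_real (x.2 - y.2))).
rewrite sqrrD addrAC lerDl.
by rewrite mulrn_wge0// mulr_ge0.
Qed.

(** After squaring, the two sides differ by [2 * e * (d + (x.1 - y.1))], where [d] is the distance
    of [x] and [y] and dominates [|x.1 - y.1|]. *)
Lemma euclidean_dist_shift x y (e : R) : 0 <= e ->
  euclidean_dist x (y.1 + e, y.2) <= euclidean_dist x y + e.
Proof.
move=> e0; rewrite {1}/euclidean_dist /=.
have d0 := euclidean_dist_ge0 x y.
rewrite -[leRHS]ger0_norm ?addr_ge0// -sqrtr_sqr ler_wsqrtr//.
rewrite (sqrrD (euclidean_dist x y)).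
have -> : euclidean_dist x y ^+ 2 = (x.1 - y.1) ^+ 2 + (x.2 - y.2) ^+ 2.
  by rewrite sqr_sqrtr ?addr_ge0 ?sqr_ge0.
have := euclidean_dist_fst x y; rewrite ler_norml => /andP[h _].
have : 0 <= (euclidean_dist x y + (x.1 - y.1)) * e by rewrite mulr_ge0//; lra.
by move: (euclidean_dist x y) => s hs; nra.
Qed.

Lemma diam_ge0 V : (0 <= diam V)%E.
Proof. by rewrite /diam le_max lexx. Qed.

Lemma dist_le_diam V x y : V x -> V y -> ((euclidean_dist x y)%:E <= diam V)%E.
Proof.
move=> Vx Vy; rewrite /diam le_max; apply/orP; right.
by apply: ereal_sup_ubound; exists x => //; exists y.
Qed.

Lemma diam_le V (c : R) : 0 <= c ->
  (forall x y, V x -> V y -> euclidean_dist x y <= c) -> (diam V <= c%:E)%E.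
Proof.
move=> c0 h; rewrite /diam ge_max lee_fin c0/=.
by apply: ge_ereal_sup => _ [x Vx [y Vy <-]]; rewrite lee_fin h.
Qed.

Lemma diam_fineK V (c : R) : (diam V <= c%:E)%E -> diam V = (fine (diam V))%:E.
Proof.
move=> Vc; rewrite fineK// fin_numElt (lt_le_trans _ (diam_ge0 V)) ?ltNyr//=.
by rewrite (le_lt_trans Vc) ?ltry.
Qed.

(* A point moved away from V along a horizontal line is added at the last
   moment when the diameter does not exceed rho. *)
Lemma extend_diam V (rho : R) : 0 <= rho -> (diam V <= rho%:E)%E ->
  exists2 W, V `<=` W & diam W = rho%:E.
Proof.
move=> rho0; wlog [x Vx] : V / V !=set0.
  move=> h; case: (eqVneq V set0) => [->|/set0P]; last exact: h.
  move=> _; have [|| W _ hW] := h [set ((0 : R), (0 : R))]; first by exists (0, 0).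
    by apply: diam_le => // x y -> ->; rewrite euclidean_distxx.
  by exists W.
move=> Vrho.
have dV u v : V u -> V v -> euclidean_dist u v <= rho.
  by move=> Vu Vv; rewrite -lee_fin (le_trans (dist_le_diam Vu Vv)).
(* The shifts of [x] to the right that stay within [rho] of all of [V]. The supremum is attained,
   and by maximality some points of [V] are at distance almost [rho] from the shifted point. *)
pose T := [set t : R | 0 <= t /\ forall u, V u -> euclidean_dist u (x.1 + t, x.2) <= rho].
have T0 : T 0 by split=> // u Vu; rewrite addr0 -surjective_pairing dV.
have Tub t : T t -> t <= rho.
  move=> [t0 /(_ _ Vx)]; apply: le_trans.
  apply: le_trans (euclidean_dist_fst _ _) => /=.
  by rewrite opprD addrA subrr add0r normrN ler_norm.
have supT : has_sup T by split; [exists 0 | exists rho => t /Tub].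
have t0 : 0 <= sup T by apply: ub_le_sup => //; case: supT.
have Tsup : T (sup T).
  split=> // u Vu; apply/ler_addgt0Pr => e e0.
  have [t Tt] := sup_adherent e0 supT => te.
  have tT : t <= sup T by apply: ub_le_sup => //; case: supT.
  have := @euclidean_dist_shift u (x.1 + t, x.2) (sup T - t) ltac:(by rewrite subr_ge0).
  rewrite /= -addrA (addrC t) subrK => /le_trans; apply.
  by apply: lerD; [case: Tt => _; apply | lra].
have far e : 0 < e -> exists2 u, V u & rho - e < euclidean_dist u (x.1 + sup T, x.2).
  move=> e0; apply: contrapT => /forall2NP h.
  suff /(ub_le_sup (proj2 supT)) : T (sup T + e) by rewrite leNgt ltrDl e0.
  split; first by rewrite addr_ge0// ltW.
  move=> u Vu; rewrite addrA.
  apply: le_trans (@euclidean_dist_shift u (x.1 + sup T, x.2) e (ltW e0)) _.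
  by case: (h u) => // /negP; rewrite -leNgt lerBrDr.
exists (V `|` [set (x.1 + sup T, x.2)]); first by move=> y; left.
apply/eqP; rewrite eq_le; apply/andP; split.
  apply: diam_le => // u v [Vu|->] [Vv|->]; rewrite ?euclidean_distxx//.
  - exact: dV.
  - by case: Tsup => _; apply.
  - by rewrite euclidean_distC; case: Tsup => _; apply.
apply/lee_addgt0Pr => e e0; have [u Vu hu] := far e e0.
rewrite -leeBlDr// -EFinB (le_trans _ (@dist_le_diam _ u (x.1 + sup T, x.2) _ _))//.
- by rewrite lee_fin ltW.
- by left.
- by right.
Qed.

End Diameter.

(** * Dependence of the intermediate dimensions on theta *)

Section IntermediateCovers.
Context {R : realType}.
Implicit Types (F : set (R * R)) (s t eps delta theta phi : R).

Definition small_cover F theta s eps delta := exists I U,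
  is_cover (lower_scale theta delta) delta F I U /\ (cover_sum s I U <= eps%:E)%E.

Definition lower_exponents F theta := [set s : R | 0 <= s /\
  forall eps : R, 0 < eps -> forall delta0 : R, 0 < delta0 ->
  exists2 delta : R, 0 < delta <= delta0 & small_cover F theta s eps delta].

Definition upper_exponents F theta := [set s : R | 0 <= s /\
  forall eps : R, 0 < eps -> exists2 delta0 : R, 0 < delta0 &
  forall delta : R, 0 < delta <= delta0 -> small_cover F theta s eps delta].

Lemma lower_scale_ge0 theta delta : 0 <= lower_scale theta delta.
Proof. by rewrite /lower_scale; case: ifP => // _; exact: powR_ge0. Qed.

Lemma lower_scale_le theta phi delta : 0 <= theta <= phi -> 0 < delta <= 1 ->
  lower_scale theta delta <= lower_scale phi delta.
Proof.
move=> /andP[t0 tp] d01; rewrite {1}/lower_scale; case: eqP => [_|/eqP tn0].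
  exact: lower_scale_ge0.
have tgt0 : 0 < theta by rewrite lt_def tn0.
rewrite /lower_scale gt_eqF ?(lt_le_trans tgt0)//.
by apply: ger_powR => //; rewrite lef_pV2// posrE (lt_le_trans tgt0).
Qed.

Lemma small_cover_le F theta phi s eps delta : 0 <= theta <= phi ->
  0 < delta <= 1 -> small_cover F phi s eps delta -> small_cover F theta s eps delta.
Proof.
move=> tp d01 [I [U [[FU dU] sU]]]; exists I, U; split=> //; split=> // i Ii.
have /andP[h ->] := dU i Ii; rewrite andbT (le_trans _ h)// lee_fin.
exact: lower_scale_le.
Qed.

(** A set of diameter below [rho = delta ^ (1 / phi)] is enlarged to diameter [rho]. Its new cost
    [rho ^ (phi / theta * s) = delta ^ (s / theta)] is at most the old one, the old diameter being
    at least [delta ^ (1 / theta)]. Other sets are kept: the exponent grows and their diameter is at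
    most 1. *)
Lemma small_cover_extend F theta phi s eps delta : 0 < theta <= phi ->
  phi <= 1 -> 0 < delta <= 1 -> 0 <= s -> small_cover F theta s eps delta ->
  small_cover F phi (phi / theta * s) eps delta.
Proof.
move=> /andP[t0 tp] p1 /andP[d0 d1] s0 [I [U [[FU dU] sU]]].
have p0 : 0 < phi by apply: lt_le_trans tp.
pose rho := lower_scale phi delta.
have rhoE : rho = delta `^ phi^-1 by rewrite /rho /lower_scale gt_eqF.
have rho0 : 0 < rho by rewrite rhoE powR_gt0.
have rhod : rho <= delta.
  by rewrite rhoE ge1r_powR ?d0//; rewrite invf_ge1.
have ex_ext i : exists W, I i -> [/\ U i `<=` W, (rho%:E <= diam W <= delta%:E)%E &
    ((diam W) `^ (phi / theta * s) <= (diam (U i)) `^ s)%E].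
  have [Ii|nIi] := pselect (I i); last by exists set0 => /nIi.
  have /andP[dl du] := dU i Ii.
  have dE := diam_fineK du; move: dl du; rewrite {1 2}dE !lee_fin => dl du.
  have dU0 : 0 < fine (diam (U i)).
    by apply: lt_le_trans dl; rewrite /lower_scale gt_eqF// powR_gt0.
  have pts : s <= phi / theta * s by rewrite ler_peMl// ler_pdivlMr// mul1r.
  case: (leP rho (fine (diam (U i)))) => h.
    exists (U i) => _; split=> //; first by rewrite dE !lee_fin h.
    rewrite dE !poweR_EFin lee_fin ger_powR// dU0/=.
    exact: le_trans d1.
  have [||W UW dW] := @extend_diam R (U i) rho; first exact: ltW.
    by rewrite dE lee_fin ltW.
  exists W => _; split=> //; first by rewrite dW !lee_fin lexx.
  rewrite dW dE !poweR_EFin lee_fin rhoE -powRrM mulrA mulrA mulVf ?gt_eqF// mul1r.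
  rewrite powRrM ge0_ler_powR// ?nnegrE ?powR_ge0// ?(ltW dU0)//.
  by move: dl; rewrite /lower_scale gt_eqF.
have [V hV] := choice ex_ext.
exists I, V; split.
  split; first by move=> x /FU[i Ii Uix]; exists i => //; case: (hV i Ii) => + _ _; apply.
  by move=> i Ii; case: (hV i Ii).
apply: le_trans sU; apply: le_esum => i Ii.
by case: (hV i Ii).
Qed.

Lemma lower_exponents_antimono F theta phi : 0 <= theta <= phi ->
  lower_exponents F phi `<=` lower_exponents F theta.
Proof.
move=> tp s [s0 h]; split=> // eps e0 delta0 dl0.
(* The cap at 1 is needed because [delta ^ (1 / theta)] increases with [theta] only for
   [delta <= 1]. *)
have [|delta] := h eps e0 (Num.min delta0 1); first by rewrite lt_min dl0/=.
rewrite le_min => /and3P[d0 dd0 d1] hd; exists delta; first by rewrite d0.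
by apply: small_cover_le hd => //; rewrite d0.
Qed.

Lemma upper_exponents_antimono F theta phi : 0 <= theta <= phi ->
  upper_exponents F phi `<=` upper_exponents F theta.
Proof.
move=> tp s [s0 h]; split=> // eps e0.
have [delta0 dl0 hd] := h eps e0; exists (Num.min delta0 1); first by rewrite lt_min dl0/=.
move=> delta; rewrite le_min => /and3P[d0 dd0 d1].
by apply: (@small_cover_le _ _ phi); rewrite ?d0//; apply: hd; rewrite d0.
Qed.

Lemma lower_exponents_scale F theta phi s : 0 < theta <= phi -> phi <= 1 ->
  lower_exponents F theta s -> lower_exponents F phi (phi / theta * s).
Proof.
move=> tp p1 [s0 h]; split.
  by case/andP: tp => t0 tp; rewrite mulr_ge0// divr_ge0// ltW// (lt_le_trans t0).
move=> eps e0 delta0 dl0.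
have [|delta] := h eps e0 (Num.min delta0 1); first by rewrite lt_min dl0/=.
rewrite le_min => /and3P[d0 dd0 d1] hd; exists delta; first by rewrite d0.
by apply: small_cover_extend => //; rewrite d0.
Qed.

Lemma upper_exponents_scale F theta phi s : 0 < theta <= phi -> phi <= 1 ->
  upper_exponents F theta s -> upper_exponents F phi (phi / theta * s).
Proof.
move=> tp p1 [s0 h]; split.
  by case/andP: tp => t0 tp; rewrite mulr_ge0// divr_ge0// ltW// (lt_le_trans t0).
move=> eps e0.
have [delta0 dl0 hd] := h eps e0; exists (Num.min delta0 1); first by rewrite lt_min dl0/=.
move=> delta; rewrite le_min => /and3P[d0 dd0 d1].
by apply: small_cover_extend => //; rewrite ?d0//; apply: hd; rewrite d0.
Qed.

Lemma upper_lower_exponents F theta : upper_exponents F theta `<=` lower_exponents F theta.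
Proof.
move=> s [s0 h]; split=> // eps e0 delta0 dl0; have [d1 d10 hd] := h eps e0.
have m0 : 0 < Num.min delta0 d1 by rewrite lt_min dl0.
exists (Num.min delta0 d1); rewrite ?m0 ?ge_min ?lexx//.
by apply: hd; rewrite m0 ge_min lexx orbT.
Qed.

(** For [theta = 0] the lower scale is 0, so a cover at scale [delta <= delta0] competes in the
    premeasure at [delta0], which is thus at most every [eps]. *)
Lemma lower_exponents0_hausdorff F :
  lower_exponents F 0 `<=` [set s : R | 0 <= s /\ hausdorff_measure s F = 0%E].
Proof.
move=> s [s0 h]; split=> //; apply/eqP; rewrite eq_le; apply/andP; split.
  apply: ge_ereal_sup => _ [delta0 /= dl0 <-].
  apply/lee_addgt0Pr => eps e0; rewrite add0e.
  have [delta /andP[d0 dd] [I [U [[FU dU] sU]]]] := h eps e0 delta0 dl0.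
  apply: le_trans sU; apply: ereal_inf_lbound; exists I, U; split=> //; split=> // i Ii.
  have /andP[h1 h2] := dU i Ii.
  by rewrite diam_ge0/= (le_trans h2)// lee_fin.
apply: le_trans (ereal_sup_ubound _); last by exists 1 => //=.
apply: le_ereal_inf_tmp => _ [I [U [_ ->]]].
by apply: esum_ge0 => i _; apply: poweR_ge0.
Qed.

End IntermediateCovers.

(** * Continuity on the unit interval from monotonicity and scaling *)

Section ContinuityFromScaling.
Context {R : realType}.
(** Stands for [lower_exponents F] or [upper_exponents F], so that [g] below is either intermediate
    dimension. *)
Variable S : R -> set R.
Hypothesis S_ge0 : forall theta s, S theta s -> 0 <= s.
Hypothesis S_neq0 : forall theta, 0 <= theta <= 1 -> S theta !=set0.
Hypothesis S_antimono : forall theta phi, 0 <= theta <= phi -> S phi `<=` S theta.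
Hypothesis S_scale : forall theta phi s, 0 < theta <= phi -> phi <= 1 ->
  S theta s -> S phi (phi / theta * s).

Let g theta := inf (S theta).

Let S_lb theta : has_lbound (S theta).
Proof. by exists 0 => s /S_ge0. Qed.

Lemma inf_exponents_mono theta phi : 0 <= theta <= phi -> phi <= 1 ->
  g theta <= g phi.
Proof.
move=> tp p1; apply: lb_le_inf.
  by apply: S_neq0; case/andP: tp => t0 tp; rewrite (le_trans t0 tp).
by move=> s /(S_antimono tp) ?; apply: ge_inf.
Qed.

Lemma inf_exponents_scale theta phi : 0 < theta <= phi -> phi <= 1 ->
  g phi <= phi / theta * g theta.
Proof.
move=> tp p1; have /andP[t0 t_p] := tp.
have p0 : 0 < phi by apply: lt_le_trans t_p.
rewrite -ler_pdivrMl ?divr_gt0// invf_div; apply: lb_le_inf.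
  by apply: S_neq0; rewrite (ltW t0) (le_trans t_p).
move=> s Ss; rewrite -invf_div ler_pdivrMl ?divr_gt0//.
by apply: ge_inf => //; apply: S_scale.
Qed.

Lemma inf_exponents_ge0 theta : 0 <= theta <= 1 -> 0 <= g theta.
Proof. by move=> t01; apply: lb_le_inf; [exact: S_neq0 | move=> s /S_ge0]. Qed.

(** Monotonicity and scaling place [g y] between [g x] and [(y / x) * g x], whichever of [x] and [y]
    is larger; the right-hand side is the distance between these two values. *)
Lemma inf_exponents_dist x y : 0 < x <= 1 -> 0 < y <= 1 ->
  `|g x - g y| <= `|x - y| * (g x / x).
Proof.
move=> /andP[x0 x1] /andP[y0 y1].
have gx0 : 0 <= g x by apply: inf_exponents_ge0; rewrite ltW.
have -> : `|x - y| * (g x / x) = `|g x - g x * (y / x)|.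
  rewrite -[g x / x in LHS]ger0_norm ?divr_ge0// ?ltW// -normrM; congr (`|_|).
  by field; rewrite gt_eqF.
case: (leP x y) => xy.
  have := inf_exponents_mono (theta := x) (phi := y); rewrite (ltW x0) xy => /(_ isT y1) h1.
  have := inf_exponents_scale (theta := x) (phi := y); rewrite x0 xy => /(_ isT y1) h2.
  rewrite !ler0_norm ?subr_le0// ?opprB; first by rewrite lerD2r mulrC.
  by rewrite (le_trans h1)// mulrC.
have := inf_exponents_mono (theta := y) (phi := x); rewrite (ltW y0) (ltW xy) => /(_ isT x1) h1.
have := inf_exponents_scale (theta := y) (phi := x); rewrite y0 (ltW xy) => /(_ isT x1) h2.
have h3 : g x * (y / x) <= g y.
  by rewrite mulrC -ler_pdivlMl ?divr_gt0// invf_div.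
rewrite !ger0_norm ?subr_ge0//; first by rewrite lerD2l lerN2.
exact: le_trans h1.
Qed.

Lemma inf_exponents_continuous :
  g theta @[theta --> 0^'+] --> g 0 -> {within `[0, 1], continuous g}.
Proof.
move=> g0.
(* An arbitrary filter serves both the interior points and the one-sided limit at 1. *)
have gc (x : R) : 0 < x <= 1 -> forall A : set_system R, Filter A -> A --> x ->
    (\forall y \near A, 0 < y <= 1) -> g y @[y --> A] --> g x.
  move=> x01 A FA Ax A01; apply/cvgrPdist_le => e e0.
  have c0 : 0 < 1 + g x / x.
    rewrite ltr_pwDl// divr_ge0//; last by case/andP: x01 => /ltW.
    by apply: inf_exponents_ge0; case/andP: x01 => /ltW -> ->.
  have {}Ax : \forall y \near A, `|x - y| <= e / (1 + g x / x).
    by move/cvgrPdist_le : Ax; apply; rewrite divr_gt0.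
  near=> y.
  have y01 : 0 < y <= 1 by near: y.
  apply: le_trans (inf_exponents_dist x01 y01) _.
  have : `|x - y| <= e / (1 + g x / x) by near: y.
  rewrite ler_pdivlMr//; apply: le_trans; rewrite ler_wpM2l//.
  by rewrite lerDr.
apply/continuous_within_itvP => //; split.
- move=> x; rewrite in_itv/= => /andP[x0 x1].
  apply: (gc x) => //; first by rewrite x0 ltW.
  have : x \in `]0, 1[ by rewrite in_itv/= x0.
  move=> /near_in_itvoo; apply: filterS => y; rewrite in_itv/= => /andP[-> /ltW ->].
  by [].
- exact: g0.
- apply: (gc 1) => //; first by rewrite ltr01 lexx.
    exact: cvg_within.
  near=> y; apply/andP; split; [near: y; exact: nbhs_left_gt | near: y; exact: nbhs_left_le].
Unshelve. all: by end_near. Qed.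

End ContinuityFromScaling.

(** * Words and cylinders *)

Section Coding.
Context {T : Type}.
Implicit Types (P : T -> nat) (g h : nat -> T).

(** A base [b] numeral whose leading digit is [P (g 0)]: the index of the level [k] column or row of
    the grid that contains a cylinder. *)
Fixpoint code (b : nat) P g k : nat :=
  if k is k'.+1 then (code b P g k' * b + P (g k'))%N else 0%N.

Lemma code_ltn b P g k : (forall t, P t < b)%N -> (code b P g k < b ^ k)%N.
Proof.
move=> Pb; elim: k => [|k IH] /=; first by rewrite expn0.
have := Pb (g k); rewrite expnSr; nia.
Qed.

Lemma eq_code b P g h k : (forall j, (j < k)%N -> P (g j) = P (h j)) ->
  code b P g k = code b P h k.
Proof.
elim: k => //= k IH gh; rewrite IH ?gh// => j jk; apply: gh.
by rewrite ltnS ltnW.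
Qed.

Lemma code_inj b P g h k : (forall t, P t < b)%N -> code b P g k = code b P h k ->
  forall j, (j < k)%N -> P (g j) = P (h j).
Proof.
move=> Pb; elim: k => //= k IH.
have b0 : (0 < b)%N by apply: leq_ltn_trans (Pb (g 0%N)).
move=> e; have := congr1 (modn^~ b) e; have := congr1 (divn^~ b) e => /=.
rewrite !modnMDl !divnMDl// !(modn_small (Pb _)) !(divn_small (Pb _)) !addn0.
by move=> /IH {}IH Pk j; rewrite ltnS leq_eqVlt => /predU1P[->|/IH].
Qed.

End Coding.

Section Cylinders.
Context {R : realType} {T : Type}.
Variables (m n : nat) (P Q : T -> nat).
Hypotheses (m_gt0 : (0 < m)%N) (n_gt0 : (0 < n)%N).
Implicit Types (g h : nat -> T) (x y : R * R).

Definition digit_map (t : T) x : R * R :=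
  ((x.1 + (P t)%:R) / m%:R, (x.2 + (Q t)%:R) / n%:R).

(** The digit [g 0] is the outermost map, so the first digits fix the position at coarse scales. *)
Fixpoint cylinder_map g k x : R * R :=
  if k is k'.+1 then cylinder_map g k' (digit_map (g k') x) else x.

Lemma cylinder_mapE g k x : cylinder_map g k x =
  ((x.1 + (code m P g k)%:R) / m%:R ^+ k, (x.2 + (code n Q g k)%:R) / n%:R ^+ k).
Proof.
have m0 : m%:R != 0 :> R by rewrite pnatr_eq0 -lt0n.
have n0 : n%:R != 0 :> R by rewrite pnatr_eq0 -lt0n.
elim: k x => [|k IH] x /=; first by rewrite !addr0 !expr0 !divr1 -surjective_pairing.
rewrite IH /= !natrD !natrM !exprSr; congr pair.
  by field; rewrite m0 expf_neq0.
by field; rewrite n0 expf_neq0.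
Qed.

Lemma cylinder_map_split g k l x : exists h,
  cylinder_map g (k + l) x = cylinder_map g k (cylinder_map h l x).
Proof.
exists (fun j => g (k + j)%N); elim: l x => [|l IH] x; first by rewrite addn0.
by rewrite addnS /= IH.
Qed.

Lemma eq_cylinder_map g h k x : (forall j, (j < k)%N -> g j = h j) ->
  cylinder_map g k x = cylinder_map h k x.
Proof.
elim: k x => //= k IH x gh; rewrite gh// IH// => j jk; apply: gh.
by rewrite ltnS ltnW.
Qed.

Variable F : set (R * R).
Hypothesis F01 : F `<=` `[0, 1] `*` `[0, 1].

Section Invariant.
Hypothesis F_digit : forall t x, F x -> F (digit_map t x).

Lemma cylinder_map_in g k x : F x -> F (cylinder_map g k x).
Proof. by elim: k x => //= k IH x Fx; apply/IH/F_digit. Qed.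

(** The last [K - k] maps keep the point in [F], hence in the unit square, and the first [k] maps
    send that square to one cell of the grid. Using different [k] in the two coordinates yields
    approximate squares. *)
Lemma cylinder_bounds g k K x : (k <= K)%N -> F x ->
  [/\ (code m P g k)%:R <= m%:R ^+ k * (cylinder_map g K x).1,
      m%:R ^+ k * (cylinder_map g K x).1 <= (code m P g k)%:R + 1,
      (code n Q g k)%:R <= n%:R ^+ k * (cylinder_map g K x).2 &
      n%:R ^+ k * (cylinder_map g K x).2 <= (code n Q g k)%:R + 1].
Proof.
move=> kK Fx; rewrite -(subnKC kK).
have [h ->] := cylinder_map_split g k (K - k) x.
have := cylinder_map_in h (K - k) Fx; move: (cylinder_map h _ x) => y Fy.
have m0 : m%:R != 0 :> R by rewrite pnatr_eq0 -lt0n.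
have n0 : n%:R != 0 :> R by rewrite pnatr_eq0 -lt0n.
rewrite cylinder_mapE /= !(mulrC (_ ^+ k)) !divfK ?expf_neq0//.
have [] := F01 Fy; rewrite /= !in_itv/= => /andP[y1 y1'] /andP[y2 y2'].
by split; lra.
Qed.

End Invariant.

Lemma cylinder_cover : inhabited T ->
  (forall x, F x -> exists t y, F y /\ x = digit_map t y) ->
  forall K x, F x -> exists g y, F y /\ x = cylinder_map g K y.
Proof.
move=> [t0] Fx; elim=> [|K IH] x; first by exists (fun=> t0), x.
move=> /IH[g [y [/Fx[t [z [Fz ->]]] ->]]].
exists (fun j => if j == K then t else g j), z; split=> //=.
rewrite eqxx; apply: eq_cylinder_map => j jK.
by rewrite ltn_eqF.
Qed.

End Cylinders.

Section Words.
Context {T : finType} {K : nat}.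

(* Beyond position K the letter is junk, namely the first one. *)
Definition word_seq (w : {ffun 'I_K.+1 -> T}) : nat -> T := fun j => w (inord j).

Lemma word_seq_ord (w : {ffun 'I_K.+1 -> T}) (j : 'I_K.+1) : word_seq w j = w j.
Proof. by rewrite /word_seq inord_val. Qed.

End Words.

(** * Covers by approximate squares *)

Section FiniteCovers.
Context {R : realType}.
Implicit Types (s rho : R).

(** Covers are indexed by naturals; [pickle] turns a family over any finite type into one. *)
Lemma finite_cover (J : finType) (G : pred J) (V : J -> set (R * R)) s :
  exists I U, [/\ forall j, G j -> exists2 i, I i & U i = V j,
    forall i, I i -> exists2 j, G j & U i = V j &
    cover_sum s I U = (\sum_(j | G j) (diam (V j)) `^ s)%E].
Proof.
exists (pickle @` [set j | G j]), (fun i => if unpickle i is Some j then V j else set0).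
split.
- by move=> j Gj; exists (pickle j); [exists j | rewrite pickleK].
- by move=> _ [j Gj <-]; exists j; rewrite ?pickleK.
rewrite /cover_sum esum_image; last by move=> i j _ _ /(pcan_inj pickleK).
under eq_esum do rewrite pickleK.
rewrite -[X in esum X]set_mem_set esum_fset//.
- rewrite set_mem_set (fsbigE (enum G)) ?enum_uniq//.
  + rewrite big_enum_cond; apply: eq_bigl => j.
    by apply/andP/idP => [[_ /set_mem]|Gj]; last by split; [|exact/mem_set].
  + by move=> j /=; rewrite mem_enum.
  + by move=> j /= Gj; rewrite mem_enum -topredE/= Gj.
- by move=> i _; exact: poweR_ge0.
Qed.

Definition square (x : R * R) rho : set (R * R) :=
  `[x.1, x.1 + rho] `*` `[x.2, x.2 + rho].

Lemma diam_square x rho : 0 <= rho ->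
  (rho%:E <= diam (square x rho) <= (2 * rho)%:E)%E.
Proof.
move=> r0; apply/andP; split.
  have sq1 : square x rho x by split; rewrite /= in_itv/= lexx lerDl.
  have sq2 : square x rho (x.1 + rho, x.2) by split; rewrite /= in_itv/= lexx lerDl// r0.
  apply: le_trans (dist_le_diam sq2 sq1); rewrite lee_fin.
  by apply: le_trans (euclidean_dist_fst _ _) => /=; rewrite addrAC subrr add0r ler_norm.
apply: diam_le => [|y z]; first by rewrite mulr_ge0.
move=> [/= /[!in_itv]/= /andP[y1 y1'] /andP[y2 y2']].
move=> [/= /[!in_itv]/= /andP[z1 z1'] /andP[z2 z2']].
apply: le_trans (euclidean_dist_le _ _) _.
by rewrite mulr_natl mulr2n lerD// ler_norml; apply/andP; split; lra.
Qed.

End FiniteCovers.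

(** * McMullen weights and masses of approximate squares *)

Section Weights.
Context {R : realType} {T : finType}.
Variables (m n : nat) (P Q : T -> nat).
Hypotheses (m_gt1 : (1 < m)%N) (m_lt_n : (m < n)%N).

Definition fiber_card (t : T) : nat := #|[pred t' | P t' == P t]|.

Lemma fiber_card_gt0 t : (0 < fiber_card t)%N.
Proof. by apply/card_gt0P; exists t; rewrite inE. Qed.

Let L : R := log_base n%:R m%:R.
Let a t : R := ln (fiber_card t)%:R.

(* This is [m ^ d] with [d] given by McMullen's formula: summing over digits
   instead of columns turns [n_p ^ L] into [a ^ (L - 1)]. *)
Definition mcmullen_sum : R := \sum_t expR ((log_base n%:R m%:R - 1) * ln (fiber_card t)%:R).
Let Z := mcmullen_sum.
Let b t : R := expR ((L - 1) * a t) / Z.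

Definition log_fibers (g : nat -> T) k : R := \sum_(j < k) ln (fiber_card (g j))%:R.

Let a_ge0 t : 0 <= a t.
Proof. by apply: ln_ge0; rewrite ler1n fiber_card_gt0. Qed.

Lemma mcmullen_sum_gt0 (t0 : T) : 0 < Z.
Proof.
rewrite /Z /mcmullen_sum (bigD1 t0)//= ltr_pwDl ?expR_gt0//.
by apply: sumr_ge0 => t _; exact: expR_ge0.
Qed.

Lemma log_fibers_ge0 g k : 0 <= log_fibers g k.
Proof. by apply: sumr_ge0 => j _; exact: a_ge0. Qed.

Lemma log_fibers_le g k (amax : nat) : (forall t, (fiber_card t <= amax)%N) ->
  log_fibers g k <= k%:R * ln amax%:R.
Proof.
move=> amaxP; rewrite mulr_natl -[X in _ *+ X]card_ord -sumr_const.
apply: ler_sum => j _; rewrite ler_ln ?posrE ?ltr0n ?fiber_card_gt0 ?ler_nat//.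
exact: leq_trans (fiber_card_gt0 (g j)) _.
Qed.

Let word_weight k (w : {ffun 'I_k.+1 -> T}) : R := \prod_j b (w j).
(** The mass, under the product of the weights [b], of the approximate square in column [X] of level
    [k.+1] and row [Y] of level [l]. *)
Let square_weight k l X Y : R := \sum_(w : {ffun 'I_k.+1 -> T} |
  (code m P (word_seq w) k.+1 == X) && (code n Q (word_seq w) l == Y)) word_weight w.

Lemma weights_sum (t0 : T) : \sum_t b t = 1.
Proof. by rewrite -mulr_suml divff// gt_eqF// mcmullen_sum_gt0. Qed.

(** The total weight of all words is 1, and each word counts for at most one pair of indices. *)
Lemma square_weight_sum (t0 : T) k l (A B : nat) :
  \sum_(X < A) \sum_(Y < B) square_weight k l X Y <= 1.
Proof.
have -> : 1 = \sum_(w : {ffun 'I_k.+1 -> T}) word_weight w :> R.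
  rewrite -(bigA_distr_bigA (fun _ t => b t)).
  by under eq_bigr do rewrite (weights_sum t0); rewrite prodr_const expr1n.
pose G (w : {ffun 'I_k.+1 -> T}) (X Y : nat) :=
  (code m P (word_seq w) k.+1 == X) && (code n Q (word_seq w) l == Y).
have -> : \sum_(X < A) \sum_(Y < B) square_weight k l X Y =
    \sum_(w : {ffun 'I_k.+1 -> T}) \sum_(X < A) \sum_(Y < B)
      (if G w X Y then word_weight w else 0).
  under eq_bigr => X _ do under eq_bigr => Y _ do rewrite /square_weight big_mkcond /=.
  under eq_bigr => X _ do rewrite exchange_big /=.
  by rewrite exchange_big.
have w0 (w : {ffun 'I_k.+1 -> T}) : 0 <= word_weight w.
  apply: prodr_ge0 => j _.
  by rewrite divr_ge0 ?expR_ge0// ltW// (mcmullen_sum_gt0 t0).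
apply: ler_sum => w _; rewrite pair_big /= -big_mkcond /=.
have [[X0 Y0] Gp0|noG] := pickP (fun p : 'I_A * 'I_B => G w p.1 p.2); last by rewrite big_pred0.
rewrite (big_pred1 (X0, Y0))// => -[X Y].
change (G w X Y = ((X, Y) == (X0, Y0))).
have /andP[/eqP hX /eqP hY] : G w X0 Y0 by [].
rewrite /G hX hY.
by rewrite xpair_eqE; congr andb; rewrite eq_sym.
Qed.

(** The square contains all words that agree with [g] up to [l] and share its columns up to [k]. A
    position below [l] gives a factor of at least [a ^ (L - 1) / Z]; a later one gives the weight of
    a whole column, [a * a ^ (L - 1) / Z = a ^ L / Z]. *)
Lemma square_weight_lb (g : nat -> T) k l : (l <= k.+1)%N ->
  expR (L * log_fibers g k.+1 - log_fibers g l) / Z ^+ k.+1 <=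
  square_weight k l (code m P g k.+1) (code n Q g l).
Proof.
move=> lk; have Z0 : 0 < Z := mcmullen_sum_gt0 (g 0%N).
have b0 t : 0 < b t by rewrite divr_gt0 ?expR_gt0.
pose Fm (j : 'I_k.+1) : pred T :=
  [pred t | (P t == P (g j)) && ((j < l)%N ==> (Q t == Q (g j)))].
apply: (@le_trans _ _ (\sum_(w in family Fm) word_weight w)); last first.
  rewrite /square_weight [leLHS]big_mkcond [leRHS]big_mkcond.
  apply: ler_sum => w _; case: ifPn => [/familyP wF|_]; last first.
    by case: ifP => // _; apply: prodr_ge0 => j _; exact: ltW.
  have wg j : (j < k.+1)%N -> P (word_seq w j) = P (g j).
    by move=> jk; have := wF (inord j); rewrite !inE inordK// => /andP[/eqP].
  have wgQ j : (j < l)%N -> Q (word_seq w j) = Q (g j).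
    move=> jl; have := wF (inord j); rewrite !inE inordK ?(leq_trans jl)//.
    by move=> /andP[_ /= /eqP].
  by rewrite (eq_code m wg) (eq_code n wgQ) !eqxx.
rewrite -(bigA_distr_big_dep Fm (fun _ t => b t)).
have -> : expR (L * log_fibers g k.+1 - log_fibers g l) / Z ^+ k.+1 =
    \prod_(j < k.+1) (expR (L * a (g j) - (if (j < l)%N then a (g j) else 0)) / Z).
  rewrite prodf_div prodr_const card_ord -expR_sum sumrB -mulr_sumr -big_mkcond /=.
  by rewrite /log_fibers (big_ord_widen k.+1 (fun j => a (g j)) lk).
apply: ler_prod => j _; rewrite divr_ge0 ?expR_ge0 ?(ltW Z0)//=.
case: ifPn => jl.
  rewrite (bigD1 (g j)) /Fm/= ?eqxx ?implybT// /b mulrBl mul1r lerDl.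
  by apply: sumr_ge0 => t _; exact: ltW (b0 t).
rewrite (eq_bigl (mem [pred t | P t == P (g j)])); last first.
  by move=> t; rewrite /Fm !inE (negbTE jl) andbT.
rewrite (eq_bigr (fun=> b (g j))) => [|t]; last first.
  by rewrite inE /b /a /fiber_card => /eqP ->.
rewrite sumr_const -[#|_|]/(fiber_card (g j)) subr0 -mulr_natl /b mulrA ler_pM2r ?invr_gt0//.
rewrite -[_%:R in leRHS]lnK ?posrE ?ltr0n ?fiber_card_gt0// -expRD ler_expR.
by rewrite mulrBl mul1r addrC subrK.
Qed.


(** * Levels and the choice of a good one *)

Variable N : nat.
Hypothesis N_gt0 : (0 < N)%N.
Variable amax : nat.
Hypothesis amaxP : forall t, (fiber_card t <= amax)%N.

(** Rounding down ensures [n ^ -l <= m ^ -k] for [k = next_level l], so a rectangle of width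
    [m ^ -k] and height [n ^ -l] fits into a square of side [m ^ -k]. *)
Definition next_level (k : nat) : nat := Num.truncn (k%:R / L).
Definition level (K r : nat) : nat := iter r next_level K.

Let lnm_gt0 : 0 < ln m%:R :> R.
Proof. by apply: ln_gt0; rewrite ltr1n. Qed.

Let lnn_gt0 : 0 < ln n%:R :> R.
Proof. by apply: ln_gt0; rewrite ltr1n (ltn_trans m_gt1). Qed.

Let L_gt0 : 0 < L.
Proof. by rewrite divr_gt0. Qed.

Let L_lt1 : L < 1.
Proof.
rewrite ltr_pdivrMr// mul1r ltr_ln ?posrE ?ltr0n ?ltr_nat//.
  exact: ltn_trans m_gt1.
by apply: (ltn_trans _ m_lt_n); apply: ltn_trans m_gt1.
Qed.

Lemma next_level_bounds k :
  L * (next_level k)%:R <= k%:R < L * (next_level k)%:R + L.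
Proof.
have /truncn_itv : 0 <= k%:R / L :> R by rewrite divr_ge0// ltW.
rewrite -/(next_level k) => /andP[].
by rewrite ler_pdivlMr// ltr_pdivrMr// mulrC => -> ; rewrite -natr1 mulrDl mul1r mulrC.
Qed.

Lemma leq_next_level k : (k <= next_level k)%N.
Proof.
have kL : 0 <= k%:R / L by rewrite mulr_ge0 ?invr_ge0 ?(ltW L_gt0).
rewrite /next_level truncn_ge_nat//.
by rewrite ler_pdivlMr// ler_piMr// ltW.
Qed.

Lemma level_ge K r : (K <= level K r)%N.
Proof. by elim: r => //= r IH; apply: leq_trans (leq_next_level _). Qed.

Lemma level_mono K r r' : (r <= r')%N -> (level K r <= level K r')%N.
Proof.
move=> /subnKC <-; elim: (r' - r)%N => [|d IH]; first by rewrite addn0.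
by rewrite addnS (leq_trans IH)//= leq_next_level.
Qed.

Lemma level_le K r : L ^+ r * (level K r)%:R <= K%:R.
Proof.
elim: r => [|r IH]; first by rewrite expr0 mul1r.
apply: le_trans IH; rewrite exprSr -mulrA ler_wpM2l ?exprn_ge0 ?(ltW L_gt0)//.
by have /andP[] := next_level_bounds (level K r).
Qed.

(* Equivalently, an approximate square of width [m ^ -k] and height [n ^ -l] has
   mass at least its width to the power [critical_exponent], up to the factor
   [amax ^ - L]. *)
Definition good_level (g : nat -> T) (l k : nat) : Prop :=
  log_fibers g l - L * log_fibers g k <= L * k%:R * (ln amax%:R / N%:R) + L * ln amax%:R.

(* The averages log_fibers g k / k lie in [0, ln amax], so along N successive
   levels they cannot decrease by more than ln amax / N at each step. *)
Lemma exists_good_level g K : (0 < K)%N ->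
  exists2 r, (r < N)%N & good_level g (level K r) (level K r.+1).
Proof.
move=> K0; apply: contrapT => /forall2NP bad.
pose A r := log_fibers g (level K r) / (level K r)%:R.
have lev0 r : 0 < (level K r)%:R :> R by rewrite ltr0n (leq_trans K0)// level_ge.
have Aub r : A r <= ln amax%:R by rewrite ler_pdivrMr// mulrC log_fibers_le.
have Alb r : 0 <= A r by rewrite divr_ge0// ?log_fibers_ge0// ltW.
have AE r : log_fibers g (level K r) = A r * (level K r)%:R by rewrite /A divfK// gt_eqF.
have step r : (r < N)%N -> ln amax%:R / N%:R < - (A r.+1 - A r).
  move=> rN; have [//|/negP] := bad r; rewrite /good_level -ltNge !AE => h.
  have /andP[_ /ltW h2] := next_level_bounds (level K r).
  rewrite -[next_level _]/(level K r.+1) in h2.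
  have Lk : 0 < L * (level K r.+1)%:R by rewrite mulr_gt0.
  rewrite opprB -(ltr_pM2l Lk).
  (* The rounding in [next_level] costs at most [L * ln amax], the additive term of [good_level]. *)
  have h3 : A r * (level K r)%:R <= A r * (L * (level K r.+1)%:R) + L * ln amax%:R.
    apply: (le_trans (ler_wpM2l (Alb r) h2)); rewrite mulrDr lerD2l mulrC.
    by rewrite ler_wpM2l// ltW.
  have := lt_le_trans h (lerB h3 (lexx _)).
  by move: (ln amax%:R / N%:R) => q; lra.
(* The drops telescope to [A 0 - A N], which would exceed [ln amax]. *)
have : \sum_(0 <= r < N) ln amax%:R / N%:R < \sum_(0 <= r < N) - (A r.+1 - A r).
  rewrite !big_mkord; apply: ltr_sum => [|r _]; last exact: step.
  by apply/hasP; exists (Ordinal N_gt0) => //; rewrite mem_index_enum.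
rewrite sumr_const_nat subn0 -[X in X < _]mulr_natr divfK ?pnatr_eq0 -?lt0n//.
rewrite sumrN telescope_sumr// opprB ltNge => /negP; apply.
by rewrite lerBlDr (le_trans (Aub 0%N))// lerDl.
Qed.


(** * The cover of the carpet by good approximate squares *)

Hypothesis P_lt : forall t, (P t < m)%N.
Hypothesis Q_lt : forall t, (Q t < n)%N.
Variable F : set (R * R).
Hypothesis F01 : F `<=` `[0, 1] `*` `[0, 1].
Hypothesis F_digit : forall t x, F x -> F (digit_map m n P Q t x).
Hypothesis F_cover : forall x, F x -> exists t y, F y /\ x = digit_map m n P Q t y.

Definition side (k : nat) : R := expR (- (k%:R * ln m%:R)).

Lemma side_inv k : side k = (m%:R ^+ k)^-1.
Proof.
rewrite /side expRN expRM_natl lnK// posrE ltr0n.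
exact: ltn_trans m_gt1.
Qed.

Lemma side_le k k' : (k <= k')%N -> side k' <= side k.
Proof. by move=> kk; rewrite ler_expR lerN2 ler_wpM2r ?ler_nat// ltW. Qed.

(** The first term is McMullen's formula for the Hausdorff dimension, the second the loss from
    having only [N] levels to choose from. *)
Definition critical_exponent : R := ln Z / ln m%:R + ln amax%:R / (N%:R * ln n%:R).

(** The cover consists of the squares, at all [N] levels, that some word reaches at a good level.
    Each costs at most a constant times its mass, and the masses of a level sum to at most 1; this
    produces the factor [N]. *)
Lemma carpet_cover (t0 : T) s K : (0 < K)%N -> critical_exponent < s -> 0 <= s ->
  exists I U, [/\ F `<=` \bigcup_(i in I) U i,
    forall i, I i -> ((side (level K N))%:E <= diam (U i) <= (2 * side K)%:E)%E &
    (cover_sum s I U <= (N%:R * (2 `^ s * expR (L * ln amax%:R)) *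
        side K `^ (s - critical_exponent))%:E)%E].
Proof.
move=> K0 s0s s_ge0.
have Z0 := mcmullen_sum_gt0 t0.
(* Common ranges for the column and row indices of all levels, introduced by existentials to keep
   the powers opaque. *)
have [A AE] : exists A, A = (m ^ level K N)%N by eexists.
have [B BE] : exists B, B = (n ^ level K N)%N by eexists.
pose J : finType := ('I_N * ('I_A * 'I_B))%type.
pose k (j : J) := level K j.1.+1.
pose l (j : J) := level K j.1.
pose G (j : J) := `[< exists g, [/\ good_level g (l j) (k j),
  code m P g (k j) = j.2.1 & code n Q g (l j) = j.2.2] >].
pose corner (j : J) : R * R := (j.2.1%:R * side (k j), j.2.2%:R / n%:R ^+ l j).
pose V (j : J) := square (corner j) (side (k j)).
have [I [U [GI IG sumU]]] := finite_cover G V s.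
have kN j : (k j <= level K N)%N by apply: level_mono.
have lN j : (l j <= level K N)%N by apply: level_mono; apply: ltnW.
have side_gt0 i : 0 < side i by exact: expR_gt0.
have n_gt0 : (0 < n)%N by rewrite (ltn_trans _ m_lt_n)// (ltn_trans _ m_gt1).
exists I, U; split.
- move=> x /(cylinder_cover (inhabits t0) F_cover (level K N))[g [y [Fy xE]]].
  have [r rN gr] := exists_good_level g K0.
  have Xlt : (code m P g (level K r.+1) < A)%N.
    by rewrite AE (leq_trans (code_ltn _ _ P_lt))// leq_exp2l// level_mono.
  have Ylt : (code n Q g (level K r) < B)%N.
    rewrite BE (leq_trans (code_ltn _ _ Q_lt))// leq_exp2l ?(ltn_trans m_gt1)//.
    by rewrite level_mono// ltnW.
  pose j : J := (Ordinal rN, (Ordinal Xlt, Ordinal Ylt)).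
  have /GI[i Ii Ui] : G j by apply/asboolP; exists g.
  exists i => //; rewrite Ui.
  have [b1 b2 _ _] := cylinder_bounds (ltnW m_gt1) n_gt0 F01 F_digit g (kN j) Fy.
  have [_ _ b3 b4] := cylinder_bounds (ltnW m_gt1) n_gt0 F01 F_digit g (lN j) Fy.
  rewrite -!xE in b1 b2 b3 b4.
  have mk0 : 0 < m%:R ^+ k j :> R by rewrite exprn_gt0// ltr0n ltnW.
  have nl0 : 0 < n%:R ^+ l j :> R by rewrite exprn_gt0// ltr0n.
  split; rewrite /= in_itv/=; apply/andP; split.
  + by rewrite side_inv ler_pdivrMr// mulrC.
  + by rewrite side_inv -[X in _ + X]mul1r -mulrDl ler_pdivlMr// mulrC.
  + by rewrite ler_pdivrMr// mulrC.
  (* The strip of height [n ^ -l] stays within the side [m ^ -k] because [L * k <= l]. *)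
  apply: (@le_trans _ _ (((code n Q g (level K r))%:R + 1) / n%:R ^+ l j)).
    by rewrite ler_pdivlMr// mulrC.
  rewrite mulrDl lerD2l mul1r.
  have -> : (n%:R ^+ l j)^-1 = expR (- ((l j)%:R * ln n%:R)) :> R.
    by rewrite expRN expRM_natl lnK// posrE ltr0n.
  rewrite ler_expR lerN2 -ler_pdivrMr// -mulrA mulrC.
  by have /andP[] := next_level_bounds (level K r).
- move=> i /IG[j _ ->].
  have /andP[h1 h2] := diam_square (corner j) (ltW (side_gt0 (k j))).
  rewrite (le_trans _ h1) ?lee_fin ?side_le// (le_trans h2)// lee_fin ler_pM2l// side_le//.
  exact: level_ge.
(* The predecessor compensates for words of length [k.+1] in [square_weight k]; all levels are
   positive. *)
pose W (r : 'I_N) (X Y : nat) := square_weight (level K r.+1).-1 (level K r) X Y.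
pose C := 2 `^ s * expR (L * ln amax%:R) * side K `^ (s - critical_exponent).
have W0 r X Y : 0 <= W r X Y.
  apply: sumr_ge0 => w _; apply: prodr_ge0 => i _.
  by rewrite divr_ge0 ?expR_ge0// ltW.
have C0 : 0 <= C by rewrite !mulr_ge0 ?powR_ge0 ?expR_ge0.
(* Of [side ^ s], the factor with exponent [critical_exponent] is paid for by the mass, and the rest
   is at most [side K ^ (s - critical_exponent)], which tends to 0. *)
have Vle j : G j -> (diam (V j) `^ s <= (C * W j.1 j.2.1 j.2.2)%:E)%E.
  move=> /asboolP[g [gg gX gY]].
  have /andP[_ h2] := diam_square (corner j) (ltW (side_gt0 (k j))).
  apply: (@le_trans _ _ ((2 * side (k j)) `^ s)%:E).
    rewrite -poweR_EFin; apply: gt0_ler_poweR => //; rewrite in_itv/= ?diam_ge0 ?leey// lee_fin.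
    by rewrite mulr_ge0// ltW.
  have kj : (k j).-1.+1 = k j.
    by rewrite prednK// (leq_trans K0)// level_ge.
  have := @square_weight_lb g (k j).-1 (l j); rewrite kj gX gY leq_next_level => /(_ isT).
  rewrite -[square_weight _ _ _ _]/(W j.1 j.2.1 j.2.2) => hW.
  rewrite lee_fin powRM// ?(ltW (side_gt0 _))// /C.
  set E := expR (L * _); rewrite -!mulrA ler_wpM2l ?powR_ge0//.
  apply: le_trans (ler_wpM2l (expR_ge0 _) (ler_wpM2l (powR_ge0 _ _) hW)).
  rewrite -[s in leLHS](subrK critical_exponent) [leLHS]powRD; last first.
    by apply/implyP => _; rewrite gt_eqF.
  rewrite [leRHS]mulrCA; apply: ler_pM; [exact: powR_ge0|exact: powR_ge0| |].
    rewrite ge0_ler_powR ?subr_ge0 ?(ltW s0s)// ?nnegrE ?(ltW (side_gt0 _))//.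
    by rewrite side_le// level_ge.
  rewrite -[Z in _ / Z ^+ _]lnK ?posrE// -expRM_natl -expRB /E -expRD.
  rewrite /side -expRM ler_expR.
  have -> : - ((k j)%:R * ln m%:R) * critical_exponent =
      - ((k j)%:R * ln Z) - L * (k j)%:R * (ln amax%:R / N%:R).
    rewrite /critical_exponent /L /log_base; field.
    by rewrite !gt_eqF// ltr0n.
  move: gg; rewrite /good_level -/L.
  move: (_ * (_ / _)) (_ * ln Z) (log_fibers g _) (L * log_fibers g _) (L * ln _).
  move=> x1 x2 x3 x4 x5.
  rewrite -subr_ge0 => /le_trans h; rewrite -subr_ge0; apply: h; rewrite le_eqVlt.
  by apply/orP; left; apply/eqP; ring.
rewrite sumU; apply: (@le_trans _ _ (\sum_(j : J) (C * W j.1 j.2.1 j.2.2)%:E)%E).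
  rewrite big_mkcond /=; apply: lee_sum => j _; case: ifP => [/Vle//|_].
  by rewrite lee_fin mulr_ge0.
rewrite sumEFin lee_fin -mulr_sumr -mulrA -/C mulrC ler_wpM2r//.
rewrite -(pair_bigA _ (fun r (p : 'I_A * 'I_B) => W r p.1 p.2)) /=.
have -> : N%:R = \sum_(r < N) 1 :> R by rewrite sumr_const card_ord.
apply: ler_sum => r _.
rewrite -(pair_bigA _ (fun X Y : 'I__ => W r X Y)) /=.
exact: square_weight_sum.
Qed.


Lemma carpet_upper_exponent (t0 : T) theta s : 0 < theta ->
  (L ^+ N)^-1 < theta^-1 -> critical_exponent < s -> 0 <= s ->
  upper_exponents F theta s.
Proof.
move=> th0 Lth s0s s_ge0; split=> // eps e0.
set q := (L ^+ N)^-1 in Lth *.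
have q0 : 0 < q by rewrite invr_gt0 exprn_gt0.
pose C : R := N%:R * (2 `^ s * expR (L * ln amax%:R)).
have C0 : 0 < C by rewrite !mulr_gt0 ?ltr0n ?powR_gt0 ?expR_gt0.
set eta := s - critical_exponent.
have eta0 : 0 < eta by rewrite subr_gt0.
(* Solves [q * (ln 2 - ln delta + ln m) <= - ln delta / theta] for [- ln delta]; this inequality
   keeps the deepest level above [delta ^ (1 / theta)]. *)
pose c : R := q * (ln 2 + ln m%:R) / (theta^-1 - q).
exists (Num.min 1 (Num.min ((eps / C) `^ eta^-1) (expR (- c)))).
  by rewrite !lt_min ltr01 powR_gt0 ?divr_gt0//= expR_gt0.
move=> delta; rewrite !le_min => /and4P[d0 d1 dC dc].
pose u : R := ln 2 - ln delta.
have u0 : 0 <= u.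
  by rewrite subr_ge0 (@le_trans _ _ 0) ?ln_le0// ln_ge0// ler1n.
have um0 : 0 <= u / ln m%:R by rewrite mulr_ge0// invr_ge0 ltW.
(* The least [K] with [2 * m ^ -K < delta]. *)
pose K := (Num.truncn (u / ln m%:R)).+1.
have /andP[] := truncn_itv um0; rewrite -/K.
rewrite ler_pdivlMr// ltr_pdivrMr// => K1 K2.
have sideK : 2 * side K <= delta.
  rewrite -[leLHS]/(2 * expR (- (K%:R * ln m%:R))) -[2 in leLHS]lnK ?posrE//.
  rewrite -expRD -[leRHS]lnK ?posrE// ler_expR lerBlDr -lerBlDl.
  exact: ltW.
have [I [U [FU dU sU]]] := @carpet_cover t0 s K isT s0s s_ge0.
exists I, U; split; [split=> // i Ii|].
  have /andP[h1 h2] := dU i Ii; apply/andP; split; last first.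
    by rewrite (le_trans h2)// lee_fin.
  rewrite (le_trans _ h1)// lee_fin /lower_scale gt_eqF//.
  rewrite /powR gt_eqF// ler_expR lerNr.
  have hlev : (level K N)%:R <= q * K%:R.
    by rewrite /q mulrC ler_pdivlMr ?exprn_gt0// mulrC level_le.
  apply: (@le_trans _ _ (q * (u + ln m%:R))).
    apply: (@le_trans _ _ (q * K%:R * ln m%:R)); first by rewrite ler_wpM2r// ltW.
    by rewrite -mulrA ler_wpM2l ?(ltW q0)// -natr1 mulrDl mul1r lerD2r.
  have := dc; rewrite -[delta in X in X -> _]lnK ?posrE// ler_expR lerNr.
  rewrite /c ler_pdivrMr ?subr_gt0// /u.
  rewrite -subr_ge0 => /le_trans h; rewrite -subr_ge0; apply: h; rewrite le_eqVlt.
  by apply/orP; left; apply/eqP; ring.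
rewrite (le_trans sU)// lee_fin -/C -ler_pdivlMl// [leRHS]mulrC.
have -> : eps / C = ((eps / C) `^ eta^-1) `^ eta.
  by rewrite -powRrM mulVf ?gt_eqF// powRr1// ltW// divr_gt0.
rewrite ge0_ler_powR ?(ltW eta0)// ?nnegrE ?expR_ge0 ?powR_ge0//.
apply: le_trans dC; apply: le_trans sideK.
by rewrite ler_peMl ?expR_ge0// ler1n.
Qed.

End Weights.

(** * Mass distribution for uniform fibers *)

Section BallCovers.
Context {R : realType}.
Implicit Types (F : set (R * R)) (s eps : R).

Lemma ler_sum_geometric (J : seq nat) eps : 0 <= eps -> uniq J ->
  \sum_(i <- J) eps / 2 ^+ i.+1 <= eps.
Proof.
move=> e0 uJ; pose N := \max_(i <- J) i.+1.
have JN i : i \in J -> (i < N)%N.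
  by move=> iJ; rewrite /N (big_rem i)//= leq_maxl.
have term0 i : 0 <= eps / 2 ^+ i.+1 by rewrite divr_ge0// exprn_ge0.
apply: (@le_trans _ _ (\sum_(i < N) eps / 2 ^+ i.+1)).
  rewrite (perm_big (seq.filter (mem J) (iota 0 N))) /=; last first.
    apply: uniq_perm => //; first by rewrite filter_uniq// iota_uniq.
    move=> i; rewrite mem_filter mem_iota /= add0n; apply/idP/andP => [iJ|[]//].
    by rewrite JN.
  rewrite big_filter big_mkcond -(big_mkord xpredT (fun i => eps / 2 ^+ i.+1)) /=.
  rewrite /index_iota subn0; apply: ler_sum => i _.
  by case: ifP.
suff -> : \sum_(i < N) eps / 2 ^+ i.+1 = eps - eps / 2 ^+ N.
  by rewrite gerBl divr_ge0// exprn_ge0.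
elim: N {JN} => [|N IH]; first by rewrite big_ord0 expr0 divr1 subrr.
by rewrite big_ord_recr /= IH exprS; field; rewrite expf_neq0.
Qed.

Lemma compact_cover_plane F : compact F -> cover_compact F.
Proof.
pose X : ptopologicalType :=
  HB.pack (R * R)%type (Topological.class (R * R)%type) (Pointed.class (R * R)%type).
by rewrite -(compact_cover X).
Qed.

(** Each [U i] is put into an open ball, and compactness leaves finitely many. Sets of tiny or zero
    diameter get a radius [tau i] with [tau i ^ s = eps / 2 ^ i.+1], which adds at most [eps] to the
    sum. Balls are for the max norm, which the Euclidean distance dominates. *)
Lemma finite_ball_cover F (r0 s eps : R) I U : compact F -> 0 < s -> 0 < eps <= 1 ->
  is_cover r0 1 F I U -> (cover_sum s I U <= eps%:E)%E ->
  exists (J : seq nat) (x : nat -> R * R) (r : nat -> R),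
    [/\ forall i, i \in J -> 0 < r i <= 1,
        forall y, F y -> exists2 i, i \in J & ball (x i) (2 * r i) y &
        \sum_(i <- J) r i `^ s <= 2 * eps].
Proof.
move=> cF s0 /andP[e0 e1] [FU dU] sU.
pose tau i : R := (eps / 2 ^+ i.+1) `^ s^-1.
have term0 i : 0 < eps / 2 ^+ i.+1 by rewrite divr_gt0// exprn_gt0.
have tau0 i : 0 < tau i by rewrite powR_gt0.
have taus i : tau i `^ s = eps / 2 ^+ i.+1.
  by rewrite -powRrM mulVf ?gt_eqF// powRr1// ltW.
have tau1 i : tau i <= 1.
  apply: (@le_trans _ _ (1 `^ s^-1)); last by rewrite powR1.
  rewrite ge0_ler_powR ?invr_ge0 ?(ltW s0)// ?nnegrE ?ler01 ?(ltW (term0 _))//.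
  rewrite ler_pdivrMr ?exprn_gt0// mul1r (le_trans e1)//.
  by rewrite exprn_ege1// ler1n.
pose d i := fine (diam (U i)).
have dE i : I i -> diam (U i) = (d i)%:E by move=> /dU/andP[_]; exact: diam_fineK.
have d0 i : 0 <= d i by apply: fine_ge0; exact: diam_ge0.
have d1 i : I i -> d i <= 1 by move=> Ii; have /andP[_] := dU i Ii; rewrite dE// lee_fin.
pose r i := Num.max (d i) (tau i).
have r0' i : 0 < r i by rewrite lt_max tau0 orbT.
pose x i : R * R := xget (0, 0) (U i).
have Uball i y : I i -> U i y -> ball (x i) (2 * r i) y.
  move=> Ii Uiy; have Uix : U i (x i) by exact: (@xgetPex _ (0, 0) _ (ex_intro _ y Uiy)).
  have dxy : euclidean_dist (x i) y < 2 * r i.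
    apply: (@le_lt_trans _ _ (r i)); last by rewrite ltr_pMl// ltr1n.
    rewrite le_max; apply/orP; left; rewrite -lee_fin -dE//.
    exact: dist_le_diam.
  by split; rewrite /ball /=; apply: le_lt_trans dxy;
    [exact: euclidean_dist_fst | exact: euclidean_dist_snd].
have := compact_cover_plane cF.
move=> /(_ nat I (fun i => ball (x i) (2 * r i))) [i _|y /FU[i Ii Uiy]|D DI FD].
- by apply: ball_open; rewrite mulr_gt0.
- by exists i => //; exact: Uball.
exists (finmap.enum_fset D), x, r; split.
- move=> i iD; rewrite r0' ge_max tau1 d1//.
  by have := DI i iD; rewrite in_setE.
- by move=> y /FD[i iD]; exists i.
have DI' i : i \in finmap.enum_fset D -> I i by move=> /DI; rewrite in_setE.
rewrite mulr_natl mulr2n.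
apply: (@le_trans _ _ (\sum_(i <- finmap.enum_fset D) (d i `^ s + eps / 2 ^+ i.+1))).
  rewrite big_seq [leRHS]big_seq; apply: ler_sum => i iD.
  rewrite /r; case: (leP (d i) (tau i)) => h.
    by rewrite taus lerDr powR_ge0.
  by rewrite lerDl ltW.
rewrite big_split /= lerD//; last by rewrite ler_sum_geometric ?(ltW e0)// finmap.fset_uniq.
rewrite -lee_fin; apply: le_trans sU; apply: esum_ge; exists [set` finmap.enum_fset D].
  by split=> // i /= /DI'.
rewrite fsbig_seq ?finmap.fset_uniq// -fsumEFin; last exact: finite_seq.
rewrite le_eqVlt; apply/orP; left; apply/eqP/eq_fsbigr => i.
by rewrite inE /= => /DI' Ii; rewrite dE// poweR_EFin.
Qed.

End BallCovers.

(** * Counting words whose points lie in a ball *)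

Section UniformFibers.
Context {R : realType} {T : finType}.
Variables (m n : nat) (P Q : T -> nat).
Hypotheses (m_gt1 : (1 < m)%N) (m_lt_n : (m < n)%N).
Hypothesis P_lt : forall t, (P t < m)%N.
Hypothesis Q_lt : forall t, (Q t < n)%N.
Hypothesis PQ_inj : forall t t', P t = P t' -> Q t = Q t' -> t = t'.
Variable F : set (R * R).
Hypothesis F01 : F `<=` `[0, 1] `*` `[0, 1].
Hypothesis F_digit : forall t x, F x -> F (digit_map m n P Q t x).
Variable Nf : nat.
Hypothesis fiber_le : forall t, (fiber_card P t <= Nf)%N.

Let G : R := #|T|%:R.

Lemma card_familyR (I : finType) (Fm : I -> pred T) :
  #|family Fm|%:R = \prod_i #|Fm i|%:R :> R.
Proof.
rewrite -sum1_card natr_sum.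
rewrite (eq_bigr (fun w : {ffun I -> T} => \prod_(i : I) (1 : R))) => [|w _]; last first.
  by rewrite big1.
rewrite -(bigA_distr_big_dep Fm (fun _ _ => 1)).
by apply: eq_bigr => i _; rewrite sumr_const.
Qed.

(** Both codes determine a letter below [l], the column code leaves at most [Nf] choices from [l] to
    [k], and later letters are free. *)
Lemma card_equal_codes K k l (w1 : {ffun 'I_K.+1 -> T}) : (l <= k)%N -> (k <= K.+1)%N ->
  #|[pred w : {ffun 'I_K.+1 -> T} |
     (code m P (word_seq w) k == code m P (word_seq w1) k) &&
     (code n Q (word_seq w) l == code n Q (word_seq w1) l)]|%:R <=
  G ^+ K.+1 * (Nf%:R / G) ^+ k / Nf%:R ^+ l.
Proof.
move=> lk kK; set S := [pred w | _].
have t0 := w1 ord0.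
have G0 : 0 < G by rewrite ltr0n; apply/card_gt0P; exists t0.
have Nf0 : 0 < Nf%:R :> R by rewrite ltr0n (leq_trans _ (fiber_le t0))// fiber_card_gt0.
pose Fm (j : 'I_K.+1) : pred T := [pred t |
  ((j < k)%N ==> (P t == P (word_seq w1 j))) && ((j < l)%N ==> (Q t == Q (word_seq w1 j)))].
apply: (@le_trans _ _ #|family Fm|%:R).
  rewrite ler_nat; apply: subset_leq_card; apply/fintype.subsetP => w.
  rewrite inE => /andP[/eqP/(code_inj P_lt) hP /eqP/(code_inj Q_lt) hQ].
  apply/familyP => j; rewrite inE; apply/andP; split; apply/implyP => jk.
    by rewrite -hP// word_seq_ord.
  by rewrite -hQ// word_seq_ord.
rewrite card_familyR.
have -> : G ^+ K.+1 * (Nf%:R / G) ^+ k / Nf%:R ^+ l =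
    \prod_(j < K.+1) (G * (if (j < k)%N then Nf%:R / G else 1) *
      (if (j < l)%N then Nf%:R^-1 else 1)).
  rewrite 2!big_split /= -!big_mkcond /= prodr_const card_ord -exprVn.
  rewrite -(big_ord_widen K.+1 (fun=> Nf%:R / G) kK) prodr_const card_ord.
  rewrite -(big_ord_widen K.+1 (fun=> Nf%:R^-1) (leq_trans lk kK)).
  by rewrite prodr_const card_ord.
apply: ler_prod => j _; rewrite ler0n /=.
case: (ltnP j l) => jl.
  have jk : (j < k)%N by apply: leq_trans lk.
  rewrite jk (mulrC G) divfK ?gt_eqF// divff ?gt_eqF// lern1.
  apply/card_le1P => t; rewrite inE jl jk => /andP[/eqP hP /eqP hQ] t'.
  rewrite !inE jl jk /=; apply/andP/eqP => [[/eqP hP' /eqP hQ']|->].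
    by apply: PQ_inj; [rewrite hP' hP | rewrite hQ' hQ].
  by rewrite hP hQ !eqxx.
rewrite mulr1; case: (ltnP j k) => jk; last first.
  by rewrite mulr1 ler_nat max_card.
rewrite mulrC divfK ?gt_eqF// ler_nat; apply: leq_trans (fiber_le (w1 j)).
by apply: subset_leq_card; apply/fintype.subsetP => t; rewrite !inE jk word_seq_ord => /andP[].
Qed.

Variable x0 : R * R.
Hypothesis Fx0 : F x0.

Definition word_point K (w : {ffun 'I_K.+1 -> T}) : R * R :=
  cylinder_map m n P Q (word_seq w) K.+1 x0.

Lemma nat_close (X X' : nat) (u v : R) : X%:R <= u -> v <= X'%:R + 1 -> u - v < 4 ->
  (X <= X' + 4)%N.
Proof.
move=> h1 h2 h3; rewrite -ltnS -(ltr_nat R).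
have -> : (X' + 4).+1%:R = X'%:R + 5 :> R by rewrite -addnS natrD.
lra.
Qed.

(** The difference to [c] takes nine values; adding 4 first keeps the truncated subtraction
    faithful. *)
Lemma inord_close_inj (c a b : nat) :
  (a <= c + 4)%N -> (c <= a + 4)%N -> (b <= c + 4)%N -> (c <= b + 4)%N ->
  inord (a + 4 - c) = inord (b + 4 - c) :> 'I_9 -> a = b.
Proof. by move=> h1 h2 h3 h4 /(congr1 val); rewrite /= !inordK; lia. Qed.

(** Both codes of a word in the set differ by at most 4 from those of one reference word, so at most
    [9 * 9 = 81] pairs of codes occur. *)
Lemma card_words_in_ball K k l (rho : R) (A : pred {ffun 'I_K.+1 -> T}) :
  (l <= k)%N -> (k <= K.+1)%N -> 0 < rho ->
  m%:R ^+ k * rho <= 1 -> n%:R ^+ l * rho <= 1 ->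
  (forall w w', w \in A -> w' \in A ->
     `|(word_point w).1 - (word_point w').1| < 4 * rho /\
     `|(word_point w).2 - (word_point w').2| < 4 * rho) ->
  #|A|%:R <= 81 * (G ^+ K.+1 * (Nf%:R / G) ^+ k / Nf%:R ^+ l).
Proof.
move=> lk kK rho0 mk nl close.
have n_gt0 : (0 < n)%N by rewrite (ltn_trans _ m_lt_n)// (ltn_trans _ m_gt1).
have m_gt0 : (0 < m)%N by rewrite (ltn_trans _ m_gt1).
have B0 : 0 <= G ^+ K.+1 * (Nf%:R / G) ^+ k / Nf%:R ^+ l.
  by rewrite !(mulr_ge0, invr_ge0, exprn_ge0)// ler0n.
have [w0 Aw0|A0] := pickP A; last by rewrite eq_card0 // mulr_ge0.
pose X (w : {ffun 'I_K.+1 -> T}) := code m P (word_seq w) k.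
pose Y (w : {ffun 'I_K.+1 -> T}) := code n Q (word_seq w) l.
have XY w w' : w \in A -> w' \in A -> (X w <= X w' + 4)%N /\ (Y w <= Y w' + 4)%N.
  move=> Aw Aw'; have [c1 c2] := close w w' Aw Aw'.
  have [a1 _ _ _] := cylinder_bounds m_gt0 n_gt0 F01 F_digit (word_seq w) kK Fx0.
  have [_ _ a3 _] := cylinder_bounds m_gt0 n_gt0 F01 F_digit (word_seq w) (leq_trans lk kK) Fx0.
  have [_ b2 _ _] := cylinder_bounds m_gt0 n_gt0 F01 F_digit (word_seq w') kK Fx0.
  have [_ _ _ b4] := cylinder_bounds m_gt0 n_gt0 F01 F_digit (word_seq w') (leq_trans lk kK) Fx0.
  split.
    apply: (nat_close a1 b2); rewrite -mulrBr.
    apply: (@lt_le_trans _ _ (m%:R ^+ k * (4 * rho))).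
      by rewrite ltr_pM2l ?exprn_gt0 ?ltr0n// (le_lt_trans (ler_norm _)).
    by rewrite mulrCA ler_piMr.
  apply: (nat_close a3 b4); rewrite -mulrBr.
  apply: (@lt_le_trans _ _ (n%:R ^+ l * (4 * rho))).
    by rewrite ltr_pM2l ?exprn_gt0 ?ltr0n// (le_lt_trans (ler_norm _)).
  by rewrite mulrCA ler_piMr.
pose f w : 'I_9 * 'I_9 := (inord (X w + 4 - X w0), inord (Y w + 4 - Y w0)).
rewrite -sum1_card natr_sum (partition_big f xpredT)//=.
have -> : 81 * (G ^+ K.+1 * (Nf%:R / G) ^+ k / Nf%:R ^+ l) =
   \sum_(p : 'I_9 * 'I_9) (G ^+ K.+1 * (Nf%:R / G) ^+ k / Nf%:R ^+ l).
  by rewrite sumr_const card_prod card_ord mulr_natl.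
apply: ler_sum => p _.
have [w1 /andP[Aw1 /eqP fw1]|A0] := pickP [pred w | (w \in A) && (f w == p)]; last first.
  by rewrite big_pred0.
apply: le_trans (card_equal_codes w1 lk kK).
rewrite -sum1_card natr_sum big_mkcond [leRHS]big_mkcond; apply: ler_sum => w _.
case: ifP => [/andP[Aw /eqP fw]|_]; last by case: ifP.
suff [eX eY] : X w = X w1 /\ Y w = Y w1.
  by rewrite inE -/(X w) -/(X w1) -/(Y w) -/(Y w1) eX eY !eqxx.
have [e1 e2] : f w = f w1 by rewrite fw fw1.
have [u1 u2] := XY _ _ Aw Aw0; have [v1 v2] := XY _ _ Aw0 Aw.
have [u3 u4] := XY _ _ Aw1 Aw0; have [v3 v4] := XY _ _ Aw0 Aw1.
by split; [exact: (inord_close_inj u1 v1 u3 v3) | exact: (inord_close_inj u2 v2 u4 v4)].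
Qed.


(** The mass distribution principle by counting: for smaller [s], a ball of radius [r] catches at
    most a fraction [C * r ^ s] of the words. All words are caught, yet these fractions sum to at
    most 1/2. *)
Lemma uniform_fibers_dimension (t0 : T) s : compact F -> 0 < s -> (0 < Nf)%N ->
  (forall eps, 0 < eps -> exists I U,
     is_cover 0 1 F I U /\ (cover_sum s I U <= eps%:E)%E) ->
  ln (G / Nf%:R) / ln m%:R + ln Nf%:R / ln n%:R <= s.
Proof.
move=> cF s0 Nf_gt0 covers; rewrite leNgt; apply/negP => sG.
have lnm0 : 0 < ln m%:R :> R by apply: ln_gt0; rewrite ltr1n.
have n_gt1 : (1 < n)%N by apply: ltn_trans m_lt_n.
have lnn0 : 0 < ln n%:R :> R by apply: ln_gt0; rewrite ltr1n.
have lnmn : ln m%:R <= ln n%:R :> R.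
  by rewrite ler_ln ?posrE ?ltr0n ?ler_nat// ?(ltnW m_lt_n)// ltnW.
have G0 : 0 < G by rewrite ltr0n; apply/card_gt0P; exists t0.
have Nf0 : 0 < Nf%:R :> R by rewrite ltr0n.
set alpha := ln (G / Nf%:R) in sG; set beta := ln Nf%:R in sG.
have beta0 : 0 <= beta by rewrite ln_ge0// ler1n.
pose C : R := 81 * expR (beta + s * ln m%:R).
have C0 : 0 < C by rewrite mulr_gt0// expR_gt0.
pose eps : R := Num.min 1 (4 * C)^-1.
have eps0 : 0 < eps by rewrite lt_min ltr01 invr_gt0 mulr_gt0.
have eps1 : 0 < eps <= 1 by rewrite eps0 ge_min lexx.
have [I [U [covU sumU]]] := covers eps eps0.
have [J [x [r [r01 Jcov sumr]]]] := finite_ball_cover cF s0 eps1 covU sumU.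
(* Up to rounding, [m ^ -k] is the radius and [n ^ -l] equals [m ^ -k]; [K] is deep enough for all
   the finitely many balls. *)
pose k i := Num.truncn (- ln (r i) / ln m%:R).
pose l i := Num.truncn ((k i)%:R * (ln m%:R / ln n%:R) : R).
pose K := \max_(i <- J) k i.
have kK i : i \in J -> (k i <= K.+1)%N.
  by move=> iJ; rewrite leqW// /K (big_rem i)//= leq_maxl.
have kP i : i \in J -> (k i)%:R * ln m%:R <= - ln (r i) < (k i).+1%:R * ln m%:R.
  move=> /r01/andP[r0 r1]; rewrite -ler_pdivlMr// -ltr_pdivrMr// truncn_itv//.
  by rewrite mulr_ge0 ?invr_ge0 ?(ltW lnm0)// oppr_ge0 ln_le0.
have lP i : (l i)%:R * ln n%:R <= ((k i)%:R * ln m%:R : R) < (l i).+1%:R * ln n%:R.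
  have : 0 <= (k i)%:R * (ln m%:R / ln n%:R) :> R.
    by rewrite !mulr_ge0 ?invr_ge0 ?ler0n// ltW.
  by move=> /truncn_itv; rewrite -/(l i) mulrA ler_pdivlMr// ltr_pdivrMr.
have lk i : (l i <= k i)%N.
  rewrite -(ler_nat R) -(ler_pM2r lnn0); have /andP[h _] := lP i.
  by apply: le_trans h _; rewrite ler_wpM2l.
pose A i : pred {ffun 'I_K.+1 -> T} := fun w => `[< ball (x i) (2 * r i) (word_point w) >].
have Acard i : i \in J -> #|A i|%:R <= C * r i `^ s * G ^+ K.+1.
  move=> iJ; have /andP[r0 r1] := r01 i iJ; have /andP[k1 k2] := kP i iJ.
  have powE (b : nat) j : (0 < b)%N -> b%:R ^+ j * r i = expR (j%:R * ln b%:R + ln (r i)).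
    by move=> b0; rewrite expRD expRM_natl !lnK// posrE ltr0n.
  apply: le_trans (card_words_in_ball (lk i) (kK i iJ) r0 _ _ _) _.
  - by rewrite powE ?(ltnW m_gt1)// -[leRHS]expR0 ler_expR -lerBrDr sub0r.
  - rewrite powE ?(ltnW n_gt1)// -[leRHS]expR0 ler_expR -lerBrDr sub0r.
    by apply: le_trans k1; case/andP: (lP i).
  - move=> w w'; rewrite !unfold_in => /asboolP[a1 a2] /asboolP[b1 b2].
    have -> : 4 * r i = 2 * r i + 2 * r i by rewrite -mulrDl -natrD.
    split; [rewrite -(subrKA (x i).1) | rewrite -(subrKA (x i).2)];
    by rewrite (le_lt_trans (ler_normD _ _))// ltrD// distrC.
  rewrite /C -!mulrA ler_pM2l// (mulrC (G ^+ _)) [leRHS]mulrA ler_pM2r ?exprn_gt0//.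
  have -> : Nf%:R / G = expR (- alpha).
    by rewrite expRN lnK ?posrE ?divr_gt0// invf_div.
  have -> : (Nf%:R ^+ l i)^-1 = expR (- ((l i)%:R * beta)).
    by rewrite expRN expRM_natl lnK.
  rewrite -expRM_natl -expRD /powR gt_eqF// -expRD ler_expR.
  have /andP[_ l2] := lP i.
  (* Rounding [l] costs [beta] and, in [h3], rounding [k] costs [s * ln m]; both are absorbed in
     [C]. The bound on [s] enters in [h2]. *)
  have h1 : (k i)%:R * ln m%:R / ln n%:R * beta <= ((l i)%:R + 1) * beta.
    by rewrite ler_wpM2r// natr1 ler_pdivrMr// ltW.
  have h2 : (k i)%:R * ln m%:R * s <= (k i)%:R * ln m%:R * (alpha / ln m%:R + beta / ln n%:R).
    by rewrite ler_wpM2l ?(ltW sG)// mulr_ge0// ltW.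
  have h3 : - ln (r i) * s <= ((k i)%:R + 1) * ln m%:R * s.
    by rewrite natr1 ler_wpM2r ?(ltW s0)// ltW.
  have e1 : (k i)%:R * ln m%:R * (alpha / ln m%:R + beta / ln n%:R) =
      (k i)%:R * alpha + (k i)%:R * ln m%:R / ln n%:R * beta.
    by field; rewrite !gt_eqF.
  rewrite e1 in h2; have := lerD (lerD h1 h2) h3.
  rewrite -subr_ge0 => /le_trans h; rewrite -subr_ge0; apply: h.
  by rewrite le_eqVlt; apply/orP; left; apply/eqP; ring.
have cover_card : G ^+ K.+1 <= \sum_(i <- J) #|A i|%:R.
  rewrite /G -natrX -[in leLHS](card_ord K.+1) -card_ffun -sum1_card natr_sum.
  under [leRHS]eq_bigr do rewrite -sum1_card natr_sum big_mkcond.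
  rewrite exchange_big /=; apply: ler_sum => w _.
  have [i iJ bi] := Jcov _ (cylinder_map_in F_digit (word_seq w) K.+1 Fx0).
  rewrite (big_rem i)//= ifT; last by apply/asboolP.
  by rewrite lerDl; apply: sumr_ge0 => j _; case: ifP.
have : G ^+ K.+1 <= C * (2 * eps) * G ^+ K.+1.
  apply: (le_trans cover_card); apply: (@le_trans _ _ (\sum_(i <- J) C * r i `^ s * G ^+ K.+1)).
    by rewrite big_seq [leRHS]big_seq; apply: ler_sum => i; exact: Acard.
  by rewrite -mulr_suml -mulr_sumr ler_pM2r ?exprn_gt0// ler_pM2l.
rewrite -[leLHS]mul1r ler_pM2r ?exprn_gt0// leNgt => /negP; apply.
apply: (@le_lt_trans _ _ (C * (2 * (4 * C)^-1))).
  by rewrite ler_pM2l// ler_pM2l// ge_min lexx orbT.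
have -> : C * (2 * (4 * C)^-1) = 2^-1 by field; rewrite gt_eqF.
by rewrite invf_lt1// ltr1n.
Qed.

End UniformFibers.

(** * The lower bound for the Hausdorff dimension *)

Lemma ln_le_of_power_le (R : realType) (Z c A u : R) (i j : nat) :
  0 < Z -> 0 < c -> 0 < A -> Z ^+ i / c ^+ j <= A * expR u ->
  i%:R * ln Z - j%:R * ln c <= ln A + u.
Proof.
move=> Z0 c0 A0 h; rewrite -ler_expR expRB expRD.
by rewrite (expRM_natl i) (expRM_natl j) !lnK ?posrE.
Qed.

Section BlockSystems.
Context {R : realType} {T : finType}.
Variables (m n : nat) (P Q : T -> nat).
Hypotheses (m_gt1 : (1 < m)%N) (m_lt_n : (m < n)%N).
Hypothesis P_lt : forall t, (P t < m)%N.
Hypothesis Q_lt : forall t, (Q t < n)%N.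
Hypothesis PQ_inj : forall t t', P t = P t' -> Q t = Q t' -> t = t'.
Variable F : set (R * R).
Hypothesis F01 : F `<=` `[0, 1] `*` `[0, 1].
Hypothesis F_digit : forall t x, F x -> F (digit_map m n P Q t x).
Hypothesis F_compact : compact F.
Hypothesis F_neq0 : F !=set0.

Let L : R := log_base n%:R m%:R.
Let Z : R := mcmullen_sum m n P.

Section FixedLength.
Variable M' : nat.
Let M := M'.+1.

(** The type of a word, as in the method of types. A count is at most the length [M'.+1], so [inord]
    loses nothing. *)
Definition column_counts (w : {ffun 'I_M'.+1 -> T}) : {ffun 'I_m -> 'I_M'.+2} :=
  [ffun p : 'I_m => inord #|[pred j | P (w j) == p]|].

Lemma prod_fiber_card (w : {ffun 'I_M -> T}) :
  (\prod_j fiber_card P (w j) =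
   \prod_(p < m) #|[pred t | P t == p]| ^ column_counts w p)%N.
Proof.
rewrite (partition_big (fun j => Ordinal (P_lt (w j))) xpredT)//=.
apply: eq_bigr => p _; rewrite ffunE inordK; last first.
  by rewrite ltnS (leq_trans (max_card _))// card_ord.
rewrite -prod_nat_const; apply: eq_big => [j|j].
  by rewrite inE; apply/eqP/eqP => [<-//|h]; apply: val_inj.
by move=> /eqP <-.
Qed.

Lemma exists_heavy_counts : T -> exists kappa : {ffun 'I_m -> 'I_M'.+2},
  Z ^+ M / M.+1%:R ^+ m <=
  \sum_(w : {ffun 'I_M -> T} | column_counts w == kappa)
    \prod_j expR ((L - 1) * ln (fiber_card P (w j))%:R).
Proof.
move=> t0; apply: contrapT => /forallNP h.
have : \sum_kappa \sum_(w : {ffun 'I_M -> T} | column_counts w == kappa)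
    \prod_j expR ((L - 1) * ln (fiber_card P (w j))%:R) <
    \sum_(kappa : {ffun 'I_m -> 'I_M'.+2}) Z ^+ M / M.+1%:R ^+ m.
  apply: ltr_sum => [|kappa _]; last by rewrite ltNge; apply/negP/h.
  by apply/hasP; exists (column_counts [ffun=> t0]); rewrite ?mem_index_enum.
rewrite sumr_const card_ffun !card_ord -[X in _ < X]mulr_natr natrX divfK; last first.
  by rewrite expf_neq0// pnatr_eq0.
pose b t : R := expR ((L - 1) * ln (fiber_card P t)%:R).
have -> : Z ^+ M = \sum_(w : {ffun 'I_M -> T}) \prod_j b (w j).
  by rewrite -(bigA_distr_bigA (fun _ t => b t)) prodr_const card_ord.
by rewrite [X in _ < X](partition_big column_counts xpredT)//= ltxx.
Qed.

(** The words of a heavy group are the digits [B] of a system in bases [m ^ M] and [n ^ M], with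
    fibers of size at most [Nf]. Their total weight [#|B| * Nf ^ (L - 1)] is at least
    [Z ^ M / M.+1 ^ m], while [uniform_fibers_dimension] bounds its logarithm by [s * M * ln m]. *)
Lemma block_dimension s : T -> 0 < s ->
  (forall eps, 0 < eps -> exists I U,
     is_cover 0 1 F I U /\ (cover_sum s I U <= eps%:E)%E) ->
  M%:R * (ln Z - s * ln m%:R) <= m%:R * ln M.+1%:R.
Proof.
move=> t0 s0 covers; have [kappa hk] := exists_heavy_counts t0.
have Z0 : 0 < Z := mcmullen_sum_gt0 m n P t0.
have lnm0 : 0 < ln m%:R :> R by apply: ln_gt0; rewrite ltr1n.
have n_gt1 : (1 < n)%N by apply: ltn_trans m_lt_n.
have lnn0 : 0 < ln n%:R :> R by apply: ln_gt0; rewrite ltr1n.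
pose B : finType := {w : {ffun 'I_M -> T} | column_counts w == kappa}.
pose PB (w : B) := code m P (word_seq (val w)) M.
pose QB (w : B) := code n Q (word_seq (val w)) M.
pose Nf := (\prod_(p < m) #|[pred t | P t == p]| ^ kappa p)%N.
have NfE (w : B) : (\prod_j fiber_card P (val w j) = Nf)%N.
  by rewrite prod_fiber_card (eqP (valP w)).
(* Equal column codes force equal columns position by position, so only the rows within these
   columns vary. *)
have fiberB (w : B) : (fiber_card PB w <= Nf)%N.
  pose Fm (j : 'I_M) : pred T := [pred t | P t == P (val w j)].
  have -> : Nf = #|family Fm|.
    by apply/eqP; rewrite -(eqr_nat R) card_familyR -(NfE w) natr_prod.
  rewrite /fiber_card -(fintype.card_image val_inj); apply: subset_leq_card.
  apply/fintype.subsetP => _ /fintype.imageP[w' + ->]; rewrite inE => /eqP/(code_inj P_lt) e.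
  by apply/familyP => j; rewrite inE -!word_seq_ord e.
have heavy : \sum_(w : {ffun 'I_M -> T} | column_counts w == kappa)
    \prod_j expR ((L - 1) * ln (fiber_card P (w j))%:R) =
    #|B|%:R * expR ((L - 1) * ln Nf%:R).
  rewrite card_sig -sum1_card natr_sum mulr_suml; apply: eq_big => // w wk.
  rewrite mul1r -expR_sum -mulr_sumr; congr (expR (_ * _)).
  rewrite -(NfE (exist _ w wk)) natr_prod /=.
  rewrite -[LHS]expRK expR_sum; congr ln; apply: eq_bigr => j _.
  by rewrite lnK// posrE ltr0n fiber_card_gt0.
rewrite heavy in hk.
have ZM0 : 0 < Z ^+ M / M.+1%:R ^+ m by rewrite divr_gt0 ?exprn_gt0 ?ltr0n.
have B0 : (0 < #|B|)%N.
  rewrite lt0n; apply/eqP => B0; move: (lt_le_trans ZM0 hk).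
  by rewrite B0 mul0r ltxx.
have /card_gt0P[w0 _] := B0.
have Nf0 : (0 < Nf)%N by rewrite (leq_trans _ (fiberB w0))// fiber_card_gt0.
have [x0 Fx0] := F_neq0.
have BF (w : B) x : F x -> F (digit_map (m ^ M) (n ^ M) PB QB w x).
  move=> Fx; rewrite /digit_map /PB /QB !natrX -cylinder_mapE ?(ltnW m_gt1) ?(ltnW n_gt1)//.
  exact: cylinder_map_in.
have := @uniform_fibers_dimension R B (m ^ M) (n ^ M) PB QB.
rewrite -{1}(exp1n M) ltn_exp2r// ltn_exp2r// => /(_ m_gt1 m_lt_n).
move=> /(_ (fun w => code_ltn _ _ P_lt) (fun w => code_ltn _ _ Q_lt)).
have inj (w w' : B) : PB w = PB w' -> QB w = QB w' -> w = w'.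
  move=> /(code_inj P_lt) hP /(code_inj Q_lt) hQ; apply/val_inj/ffunP => j.
  by rewrite -!word_seq_ord; apply: PQ_inj; [exact: hP | exact: hQ].
move=> /(_ inj F F01 BF Nf fiberB x0 Fx0 w0 s F_compact s0 Nf0 covers).
have lnX (b : nat) : (1 < b)%N -> ln (b ^ M)%:R = M%:R * ln b%:R :> R.
  by move=> b1; rewrite natrX lnXn ?ltr0n ?(ltnW b1)// mulr_natl.
rewrite !lnX// ln_div ?posrE ?ltr0n// => hs.
have M0 : 0 < M%:R :> R by rewrite ltr0n.
have {}hs : ln #|B|%:R + (L - 1) * ln Nf%:R <= s * (M%:R * ln m%:R).
  rewrite -ler_pdivrMr ?mulr_gt0//; apply: le_trans hs.
  rewrite le_eqVlt; apply/orP; left; apply/eqP; rewrite /L /log_base.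
  by field; rewrite !gt_eqF.
have M1 : 0 < M.+1%:R :> R by rewrite ltr0n.
have BR0 : 0 < #|B|%:R :> R by rewrite ltr0n.
have h := ln_le_of_power_le Z0 M1 BR0 hk.
rewrite mulrBr (mulrCA _ s) lerBlDr -lerBlDl.
exact: le_trans h hs.
Qed.

End FixedLength.

Lemma dimension_lower_bound s : T -> 0 < s ->
  (forall eps, 0 < eps -> exists I U,
     is_cover 0 1 F I U /\ (cover_sum s I U <= eps%:E)%E) ->
  ln Z / ln m%:R <= s.
Proof.
move=> t0 s0 covers.
have lnm0 : 0 < ln m%:R :> R by apply: ln_gt0; rewrite ltr1n.
rewrite ler_pdivrMr// -subr_le0 leNgt; apply/negP => D0.
set D := ln Z - _ in D0.
(* Block length [q.+2 ^ 2 - 1] makes the logarithm [2 * ln q.+2 <= 2 * (q.+2 - 1)], and the factor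
   [q.+2 - 1] of the length cancels. The left side is then unbounded in [q]. *)
have bound q : (q.+2%:R + 1) * D <= 2 * m%:R.
  have := block_dimension (q.+2 ^ 2).-2 t0 s0 covers.
  have -> : (q.+2 ^ 2).-2.+2 = (q.+2 ^ 2)%N by rewrite !expnS expn0; lia.
  have -> : ((q.+2 ^ 2).-2.+1)%:R = (q.+2%:R - 1) * (q.+2%:R + 1) :> R.
    have -> : (q.+2 ^ 2).-2.+1 = (q.+1 * q.+3)%N by rewrite !expnS expn0; lia.
    by rewrite natrM -!natr1; ring.
  rewrite natrX lnXn ?ltr0n// -/D => h.
  have q1 : 0 < q.+2%:R - 1 :> R by rewrite subr_gt0 ltr1n.
  have lnq : ln q.+2%:R <= q.+2%:R - 1 :> R.
    have := @le_ln1Dx R (q.+2%:R - 1); rewrite addrCA subrr addr0; apply.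
    by apply: lt_trans q1; rewrite oppr_lt0.
  rewrite -(ler_pM2l q1) mulrA; apply: (le_trans h).
  have -> : (q.+2%:R - 1) * (2 * m%:R) = m%:R * ((q.+2%:R - 1) *+ 2) :> R by ring.
  by rewrite ler_wpM2l// lerMn2r lnq orbT.
pose q := Num.truncn (2 * m%:R / D).
have := bound q; apply/negP; rewrite -ltNge -ltr_pdivrMr//.
have := truncnS_gt (2 * m%:R / D); rewrite -/q => /lt_trans; apply.
by rewrite natr1 ltr_nat ltnS ltnW.
Qed.

(** The exponent is raised to [s + eta] to make it positive; for sets of diameter at most 1 this
    does not increase the cost. *)
Lemma hausdorff_dimension_lower_bound s : T -> 0 <= s ->
  hausdorff_measure s F = 0%E -> ln Z / ln m%:R <= s.
Proof.
move=> t0 s0 Hs; apply/ler_addgt0Pr => eta eta0.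
apply: dimension_lower_bound => //; first exact: ltr_wpDl.
move=> eps e0.
have : (hausdorff_premeasure s 1 F < eps%:E)%E.
  apply: (@le_lt_trans _ _ 0%E); last by rewrite lte_fin.
  by rewrite -Hs; apply: ereal_sup_ubound; exists 1 => //=.
move=> /ereal_inf_lt[_ [I [U [covU ->]]] sumU]; exists I, U; split=> //.
apply: le_trans (ltW sumU); apply: le_esum => i Ii.
have /andP[_ d1] := covU.2 i Ii; have dE := diam_fineK d1.
rewrite dE in d1 *; rewrite lee_fin in d1.
have d0 : 0 <= fine (diam (U i)) by apply: fine_ge0; exact: diam_ge0.
rewrite !poweR_EFin lee_fin; have [->|dn0] := eqVneq (fine (diam (U i))) 0.
  by rewrite powR0 ?powR_ge0// gt_eqF// ltr_wpDl.
by rewrite ger_powR ?lerDl ?(ltW eta0)// lt_def dn0 d0.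
Qed.

End BlockSystems.

(** * Bedford-McMullen carpets *)

Section Carpets.
Context {R : realType} {m n : nat}.
Implicit Types D : {set 'I_m * 'I_n}.

Lemma cvg_at0_log_bound (g : R -> R) (l c theta0 : R) : 0 < theta0 <= 1 -> 0 <= c ->
  (forall theta, 0 < theta < theta0 -> l <= g theta <= l + c * (1 / - ln theta)) ->
  g theta @[theta --> 0^'+] --> l.
Proof.
move=> /andP[th0 th1] c0 gl; apply/cvgrPdist_le => e e0.
near=> theta.
have t0 : 0 < theta by near: theta; exact: nbhs_right_gt.
have tth : theta < theta0 by near: theta; exact: nbhs_right_lt.
(* This is the threshold below which [c / - ln theta] is less than [e]. *)
have te : theta < expR (- (c / e)) by near: theta; apply: nbhs_right_lt; exact: expR_gt0.
have /andP[g1 g2] := gl theta ltac:(by rewrite t0).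
rewrite distrC ger0_norm ?subr_ge0// lerBlDl (le_trans g2)// lerD2l.
have lnt0 : 0 < - ln theta by rewrite oppr_gt0 ln_lt0// t0 (lt_le_trans tth).
rewrite mulrA mulr1 ler_pdivrMr// mulrC -ler_pdivrMr// lerNr ltW//.
by rewrite -ltr_expR lnK ?posrE.
Unshelve. all: by end_near. Qed.

Lemma fiber_card_column D (t : {d : 'I_m * 'I_n | d \in D}) :
  (fiber_card (fun t' : {d : 'I_m * 'I_n | d \in D} => (val t').1 : nat) t <=
   max_column_count D)%N.
Proof.
apply: leq_trans (leq_bigmax_cond _ (valP t)); rewrite /column_count /fiber_card.
rewrite -(card_in_imset (f := fun t' : {d : 'I_m * 'I_n | d \in D} => (val t').2)).
  apply: subset_leq_card; apply/fintype.subsetP => _ /imsetP[[[p q] /= pqD] + ->].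
  by rewrite !inE /= => /eqP/val_inj <-.
move=> t1 t2; rewrite !inE => /eqP/val_inj e1 /eqP/val_inj e2 e3.
by apply: val_inj; rewrite [LHS]surjective_pairing e1 -e2 e3 -surjective_pairing.
Qed.

Lemma le_inf_subset (A B : set R) : has_lbound B -> A !=set0 -> A `<=` B ->
  inf B <= inf A.
Proof. by move=> Blb A0 AB; apply: lb_le_inf => // s /AB Bs; exact: ge_inf. Qed.

Lemma log_base_swap (a b : nat) : (1 < a)%N -> (1 < b)%N ->
  ln (log_base (a%:R : R) b%:R) = - ln (log_base (b%:R : R) a%:R).
Proof.
move=> a1 b1; rewrite /log_base -lnV ?invf_div// posrE divr_gt0// ln_gt0// ltr1n//.
Qed.

(** The largest integer strictly below [x]; it is at least half of [x], which is the origin of the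
    factor 2 in the final constant. *)
Lemma exists_level_count (x : R) : 2 < x ->
  exists N : nat, [/\ (0 < N)%N, N%:R < x & x <= 2 * N%:R].
Proof.
move=> x2; have exN : exists j : nat, x <= j.+1%:R.
  by exists (Num.truncn x); apply/ltW; exact: truncnS_gt.
case: (ex_minnP exN) => N xN minN; exists N.
have N1 : (1 < N)%N.
  by rewrite -ltnS -(ltr_nat R) (lt_le_trans x2).
split; first exact: ltnW.
  rewrite ltNge; apply/negP => xN'; have := minN N.-1.
  by rewrite prednK ?(ltnW N1)// => /(_ xN'); lia.
apply: (le_trans xN); rewrite -natr1 mulr_natl mulr2n lerD2l.
by rewrite ler1n ltnW.
Qed.

Variables (D : {set 'I_m * 'I_n}) (F : set (R * R)).
Hypotheses (m_gt1 : (2 <= m)%N) (m_lt_n : (m < n)%N) (D_gt1 : (2 <= #|D|)%N).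
Hypothesis F_carpet : is_carpet D F.

Let T : finType := {d : 'I_m * 'I_n | d \in D}.
Let P (t : T) : nat := (val t).1.
Let Q (t : T) : nat := (val t).2.
Let L : R := log_base n%:R m%:R.
Let c : R := 2 * ln (log_base m%:R n%:R) * ln (max_column_count D)%:R / ln n%:R.
Let theta0 : R := 4^-1 * log_base n%:R m%:R ^+ 2.

Let n_gt1 : (1 < n)%N.
Proof. exact: ltn_trans m_lt_n. Qed.

Let lnm_gt0 : 0 < ln m%:R :> R.
Proof. by apply: ln_gt0; rewrite ltr1n. Qed.

Let lnn_gt0 : 0 < ln n%:R :> R.
Proof. by apply: ln_gt0; rewrite ltr1n. Qed.

Let lnmn : ln m%:R < ln n%:R :> R.
Proof. by rewrite ltr_ln ?posrE ?ltr0n ?ltr_nat// ltnW. Qed.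

Let L_gt0 : 0 < L.
Proof. by rewrite divr_gt0. Qed.

Let L_lt1 : L < 1.
Proof. by rewrite ltr_pdivrMr// mul1r. Qed.

Let lnL_lt0 : ln L < 0.
Proof. by rewrite ln_lt0// L_gt0. Qed.

Let digit_exists : inhabited T.
Proof.
have /card_gt0P[d dD] : (0 < #|D|)%N by rewrite ltnW.
exact: (inhabits (exist _ d dD)).
Qed.

Let amax_gt0 : (0 < max_column_count D)%N.
Proof.
have [t0] := digit_exists.
exact: leq_trans (fiber_card_gt0 _ t0) (fiber_card_column t0).
Qed.

Lemma critical_exponent_upper theta s (N : nat) : (0 < N)%N -> 0 < theta ->
  N%:R * - ln L < - ln theta ->
  critical_exponent m n P N (max_column_count D) < s -> 0 <= s ->
  upper_exponents F theta s.
Proof.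
have [F01 Fn0 cF FE] := F_carpet; have [t0] := digit_exists.
move=> N0 th0 NL sc s0.
apply: (@carpet_upper_exponent R T m n P Q m_gt1 m_lt_n N N0 (max_column_count D)
  (fun t => fiber_card_column t) _ _ F F01 _ _ t0) => //.
- by move=> t; exact: ltn_ord.
- by move=> t; exact: ltn_ord.
- by move=> t x Fx; rewrite FE; exists (val t); [exact: valP | exists x].
- move=> x; rewrite {1}FE => -[d Dd [y Fy <-]]; exists (exist _ d Dd), y.
  by split.
rewrite -[(_ ^+ N)]lnK ?posrE ?exprn_gt0// -expRN -[theta^-1]lnK ?posrE ?invr_gt0//.
by rewrite ltr_expR -/L lnV ?posrE// lnXn// -mulr_natl -mulrN.
Qed.

Lemma hausdorff_lower_bound s : 0 <= s -> hausdorff_measure s F = 0%E ->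
  ln (mcmullen_sum m n P) / ln m%:R <= s.
Proof.
have [F01 Fn0 cF FE] := F_carpet; have [t0] := digit_exists.
apply: (@hausdorff_dimension_lower_bound R T m n P Q m_gt1 m_lt_n _ _ _ F F01 _ cF Fn0 s t0).
- by move=> t; exact: ltn_ord.
- by move=> t; exact: ltn_ord.
- move=> t t' /val_inj h1 /val_inj h2; apply: val_inj.
  by rewrite [LHS]surjective_pairing h1 h2 -surjective_pairing.
- by move=> t x Fx; rewrite FE; exists (val t); [exact: valP | exists x].
Qed.

Let theta0_gt0 : 0 < theta0.
Proof. by rewrite mulr_gt0// exprn_gt0. Qed.

Let theta0_lt1 : theta0 < 1.
Proof.
rewrite /theta0 -/L; apply: (@lt_trans _ _ (L ^+ 2)).
  by rewrite gtr_pMl ?exprn_gt0// invf_lt1// ltr1n.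
by rewrite expr_lt1// ltW.
Qed.

Let log_theta theta : 0 < theta < theta0 -> 2 * - ln L < - ln theta.
Proof.
move=> /andP[th0 th1]; rewrite mulrN ltrN2.
have h : theta < L ^+ 2.
  by apply: lt_trans th1 _; rewrite gtr_pMl ?exprn_gt0// invf_lt1// ltr1n.
by rewrite mulr_natl -lnXn// ltr_ln ?posrE ?exprn_gt0.
Qed.

(** Guards against the default value of [inf] on the empty set. One exponent at a small [th1], found
    with a single level, passes to smaller parameters by monotonicity and to larger ones by
    scaling. *)
Lemma upper_exponents_neq0 theta : 0 <= theta <= 1 -> upper_exponents F theta !=set0.
Proof.
pose th1 := theta0 / 2.
have th10 : 0 < th1 by rewrite divr_gt0.
have th11 : th1 < theta0 by rewrite ltr_pdivrMr// ltr_pMr// ltr1n.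
have [s Ss] : upper_exponents F th1 !=set0.
  pose s0 : R := critical_exponent m n P 1 (max_column_count D).
  exists (Num.max 0 s0 + 1).
  apply: (@critical_exponent_upper _ _ 1) => //.
  - apply: le_lt_trans (log_theta _); last by rewrite th10.
    by rewrite ler_wpM2r ?ler1n// oppr_ge0 ltW.
  - by rewrite (@le_lt_trans _ _ (Num.max 0 s0))// ?le_max ?lexx ?orbT// ltrDl.
  - by rewrite addr_ge0// le_max lexx.
move=> /andP[h0 h1]; case: (leP theta th1) => h.
  by exists s; apply: upper_exponents_antimono Ss; rewrite h0.
exists (theta / th1 * s); apply: upper_exponents_scale => //.
by rewrite th10 ltW.
Qed.

Lemma lower_exponents_neq0 theta : 0 <= theta <= 1 -> lower_exponents F theta !=set0.
Proof. by move=> /upper_exponents_neq0[s Ss]; exists s; apply: upper_lower_exponents. Qed.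

Let hausdorff_exponents_neq0 : [set s : R | 0 <= s /\ hausdorff_measure s F = 0%E] !=set0.
Proof.
have [|s Ss] := @lower_exponents_neq0 0; first by rewrite lexx ler01.
by exists s; exact: lower_exponents0_hausdorff.
Qed.

Lemma hausdorff_dim_lower_bound : ln (mcmullen_sum m n P) / ln m%:R <= hausdorff_dim F.
Proof. by apply: lb_le_inf => // s [s0 Hs]; exact: hausdorff_lower_bound. Qed.

Lemma hausdorff_dim_ge0 : 0 <= hausdorff_dim F.
Proof. by apply: lb_le_inf => // s []. Qed.

(** [N] is just below [ln theta / ln L], so the [N] levels fit between the two scales, and [1 / N]
    is at most [2 * ln L / ln theta]. Here [- ln L] is [ln (log_m n)]. *)
Lemma upper_dim_bound theta : 0 < theta < theta0 ->
  upper_intermediate_dim F theta <= hausdorff_dim F + c * (1 / - ln theta).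
Proof.
move=> th; have /andP[th0 th1] := th.
have lnL : 0 < - ln L by rewrite oppr_gt0.
have ln2 := log_theta th.
have lnt : 0 < - ln theta by apply: lt_trans ln2; rewrite mulr_gt0.
have amax0 : 0 <= ln (max_column_count D)%:R :> R by rewrite ln_ge0// ler1n.
have [|N [N0 N1 N2]] := @exists_level_count (- ln theta / - ln L); first by rewrite ltr_pdivlMr.
have cE : c = 2 * - ln L * ln (max_column_count D)%:R / ln n%:R.
  by rewrite /c log_base_swap.
have c0 : 0 <= c by rewrite cE !mulr_ge0 ?invr_ge0// ltW.
have crit : critical_exponent m n P N (max_column_count D) <=
    hausdorff_dim F + c * (1 / - ln theta).
  rewrite /critical_exponent lerD ?hausdorff_dim_lower_bound//.
  move: N2; rewrite ler_pdivrMr// cE.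
  move: (- ln theta) (- ln L) lnt lnL => u v u0 v0 N2.
  have -> : ln (max_column_count D)%:R / (N%:R * ln n%:R) =
      ln (max_column_count D)%:R / ln n%:R * (1 / N%:R) :> R.
    by field; rewrite !gt_eqF// ltr0n.
  have -> : 2 * v * ln (max_column_count D)%:R / ln n%:R * (1 / u) =
      ln (max_column_count D)%:R / ln n%:R * (2 * v / u) :> R.
    by field; rewrite !gt_eqF.
  rewrite ler_wpM2l ?mulr_ge0 ?invr_ge0 ?(ltW lnn_gt0)//.
  rewrite ler_pdivrMr ?ltr0n// mulrAC ler_pdivlMr// mul1r.
  by rewrite (le_trans N2)// mulrAC.
apply/ler_addgt0Pr => e e0; apply: ge_inf; first by exists 0 => s [].
apply: (@critical_exponent_upper _ _ N) => //.
- by rewrite -ltr_pdivlMr.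
- by rewrite (le_lt_trans crit)// ltrDl.
- rewrite addr_ge0 ?(ltW e0)// addr_ge0 ?hausdorff_dim_ge0//.
  by rewrite mulr_ge0// mul1r invr_ge0 ltW.
Qed.

Let exponents_ge0 (S : set R) : (forall s, S s -> 0 <= s) -> has_lbound S.
Proof. by move=> S0; exists 0 => s /S0. Qed.

(** Together with [upper_dim_bound], this traps both dimensions at [theta] between their value at 0
    and that value plus [c / - ln theta]. *)
Let dim_squeeze theta : 0 < theta < theta0 ->
  [/\ lower_intermediate_dim F 0 <= lower_intermediate_dim F theta,
      upper_intermediate_dim F 0 <= upper_intermediate_dim F theta,
      lower_intermediate_dim F theta <= upper_intermediate_dim F theta,
      hausdorff_dim F <= lower_intermediate_dim F 0 &
      hausdorff_dim F <= upper_intermediate_dim F 0].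
Proof.
move=> /andP[th0 th1]; have le1 : theta <= 1 := ltW (lt_trans th1 theta0_lt1).
have h01 : 0 <= theta <= 1 by rewrite ltW.
have h00 : 0 <= (0 : R) <= 1 by rewrite lexx ler01.
have le0 : (0 : R) <= 0 <= theta by rewrite lexx ltW.
split.
- apply: le_inf_subset; [by apply: exponents_ge0 => s [] | exact: lower_exponents_neq0 |].
  exact: lower_exponents_antimono.
- apply: le_inf_subset; [by apply: exponents_ge0 => s [] | exact: upper_exponents_neq0 |].
  exact: upper_exponents_antimono.
- apply: le_inf_subset; [by apply: exponents_ge0 => s [] | exact: upper_exponents_neq0 |].
  exact: upper_lower_exponents.
- apply: le_inf_subset; [by apply: exponents_ge0 => s [] | exact: lower_exponents_neq0 |].
  exact: lower_exponents0_hausdorff.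
- apply: le_inf_subset; [by apply: exponents_ge0 => s [] | exact: upper_exponents_neq0 |].
  by move=> s /upper_lower_exponents; exact: lower_exponents0_hausdorff.
Qed.

Let c_ge0 : 0 <= c.
Proof.
rewrite /c log_base_swap//; apply: divr_ge0; last exact: ltW.
by rewrite !mulr_ge0 ?oppr_ge0 ?(ltW lnL_lt0)// ln_ge0// ler1n.
Qed.

Lemma lower_dim_cvg0 :
  lower_intermediate_dim F theta @[theta --> 0^'+] --> lower_intermediate_dim F 0.
Proof.
apply: (@cvg_at0_log_bound _ _ c theta0) => //; first by rewrite theta0_gt0 ltW.
move=> theta th; have [-> _ lu h _] := dim_squeeze th; rewrite /= (le_trans lu)//.
by rewrite (le_trans (upper_dim_bound th))// lerD2r.
Qed.

Lemma upper_dim_cvg0 :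
  upper_intermediate_dim F theta @[theta --> 0^'+] --> upper_intermediate_dim F 0.
Proof.
apply: (@cvg_at0_log_bound _ _ c theta0) => //; first by rewrite theta0_gt0 ltW.
move=> theta th; have [_ -> _ _ h] := dim_squeeze th.
by rewrite /= (le_trans (upper_dim_bound th))// lerD2r.
Qed.

End Carpets.

Theorem proposition4p1 (R : realType) (m n : nat) (D : {set 'I_m * 'I_n})
    (F : set (R * R)) (hm : (2 <= m)%N) (hmn : (m < n)%N)
    (hD : (2 <= #|D|)%N)
    (hcol : exists p p' : 'I_m,
      [/\ column_count D p != 0%N, column_count D p' != 0%N &
          column_count D p != column_count D p'])
    (hF : is_carpet D F) :
  [/\ forall theta : R,
        0 < theta < 4^-1 * log_base n%:R m%:R ^+ 2 ->
        upper_intermediate_dim F theta <=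
          hausdorff_dim F +
          2 * ln (log_base m%:R n%:R) * ln (max_column_count D)%:R / ln n%:R *
          (1 / - ln theta),
      lower_intermediate_dim F theta @[theta --> 0^'+]
        --> lower_intermediate_dim F 0,
      upper_intermediate_dim F theta @[theta --> 0^'+]
        --> upper_intermediate_dim F 0,
      {within `[0, 1], continuous (lower_intermediate_dim F)} &
      {within `[0, 1], continuous (upper_intermediate_dim F)}].
Proof.
have lower0 := lower_dim_cvg0 hm hmn hD hF.
have upper0 := upper_dim_cvg0 hm hmn hD hF.
split; [ | exact: lower0 | exact: upper0 | | ].
- by move=> theta; exact: (upper_dim_bound hm hmn hD hF).
- apply: (@inf_exponents_continuous R (lower_exponents F)); last exact: lower0.
  + by move=> theta s [].
  + by move=> theta; exact: (lower_exponents_neq0 hm hmn hD hF).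
  + by move=> theta phi; exact: lower_exponents_antimono.
  + by move=> theta phi s; exact: lower_exponents_scale.
- apply: (@inf_exponents_continuous R (upper_exponents F)); last exact: upper0.
  + by move=> theta s [].
  + by move=> theta; exact: (upper_exponents_neq0 hm hmn hD hF).
  + by move=> theta phi; exact: upper_exponents_antimono.
  + by move=> theta phi s; exact: upper_exponents_scale.
Qed.
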